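(* Let $\alpha>0$ and $\varphi(z)=\alpha(\log^+|z|)^2$. Then: (i) every $d_\rho$-separated sequence $\Lambda\subset\mathbb{C}$ with $D^-(\Lambda)>2\alpha$ is a set of sampling for $\mathcal{F}^\infty_\varphi$; (ii) if a sequence $\Lambda\subset\mathbb{C}$ is a set of sampling for $\mathcal{F}^\infty_\varphi$, then it contains a $d_\rho$-separated subsequence $\widetilde\Lambda$ with $D^-(\widetilde\Lambda)\ge 2\alpha$.
   Context: Here $\log^+ t=\max(\log t,0)$. Sequences $\Lambda\subset\mathbb{C}$ are (countable) sets of distinct points. Put $d_\rho(z,w)=\sqrt{2\alpha}\,\frac{|z-w|}{\sqrt{2\alpha}+\min(|z|,|w|)}$; $\Lambda$ is $d_\rho$-separated if $\inf\{d_\rho(z,w):z,w\in\Lambda,\ z\neq w\}>0$. With $\mathcal{A}(r,R)=\{z: r\le|z|<R\}$, the lower density is $$D^-(\Lambda)=\liminf_{R\to+\infty}\liminf_{r\to+\infty}\frac{\operatorname{Card}(\Lambda\cap\mathcal{A}(r,Rr))}{\log R}.$$ $\mathcal{F}^\infty_\varphi$ is the space of entire functions $f$ with $\|f\|_{\varphi,\infty}=\sup_{z\in\mathbb{C}}|f(z)|e^{-\varphi(z)}<\infty$. $\Lambda$ is (a set of) sampling for $\mathcal{F}^\infty_\varphi$ if there is $L>0$ such that $\|f\|_{\varphi,\infty}\le L\sup_{\lambda\in\Lambda}|f(\lambda)|e^{-\varphi(\lambda)}$ for all $f\in\mathcal{F}^\infty_\varphi$. *)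

(* Defs.v *)
From mathcomp Require Import all_boot all_order all_algebra.
From mathcomp Require Import all_classical all_reals all_analysis.
From mathcomp Require Import complex.
Set Implicit Arguments.
Unset Strict Implicit.
Unset Printing Implicit Defensive.
Import Order.TTheory GRing.Theory Num.Theory.
Import numFieldNormedType.Exports.
Import ComplexField.Normc.
Local Open Scope classical_set_scope.
Local Open Scope ring_scope.
Local Open Scope complex_scope.

Section small_fock.
Variable R : realType.
Implicit Types (alpha r s : R) (z w : R[i]) (Lambda : set R[i]).

(* As ln 0 = 0 in the library, this is 0 at t = 0, in agreement with
   log 0 = -oo. *)
Definition logp (t : R) : R := Num.max (ln t) 0.

Definition phi alpha z : R := alpha * logp (normc z) ^+ 2.

Definition d_rho alpha z w : R :=
  Num.sqrt (2 * alpha) * normc (z - w) /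
  (Num.sqrt (2 * alpha) + Num.min (normc z) (normc w)).

Definition d_rho_separated alpha Lambda : Prop :=
  (0 < ereal_inf [set x : \bar R | exists z w,
    [/\ Lambda z, Lambda w, z <> w & x = (d_rho alpha z w)%:E]])%E.

Definition annulus r s : set R[i] := [set z | r <= normc z < s].

(* The ratio of the radii, usually written R, is s; [counting A] is +oo when A
   is infinite. *)
Definition lower_density Lambda : \bar R :=
  limf_einf (fun s : R =>
    limf_einf (fun r : R =>
      counting (Lambda `&` annulus r (s * r)) * ((ln s)^-1)%:E)%E
      (+oo : set_system R))
    (+oo : set_system R).

(* The scalars are complex in [derivable], so this is holomorphy on C. *)
Definition entire (f : R[i] -> R[i]) : Prop :=
  forall z, derivable (f : R[i]^o -> R[i]^o) z 1.

(* The supremum over the empty set is -oo rather than 0. *)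
Definition weighted_sup alpha (A : set R[i]) (f : R[i] -> R[i]) : \bar R :=
  ereal_sup [set (normc (f z) * expR (- phi alpha z))%:E | z in A].

Definition fock_norm alpha (f : R[i] -> R[i]) : \bar R :=
  weighted_sup alpha setT f.

Definition fock alpha (f : R[i] -> R[i]) : Prop :=
  entire f /\ (fock_norm alpha f < +oo)%E.

(* For Lambda empty this is false, as it is with sup of the empty set equal
   to 0: constants belong to [fock alpha]. *)
Definition sampling alpha Lambda : Prop :=
  exists2 L : R, 0 < L & forall f, fock alpha f ->
    (fock_norm alpha f <= L%:E * weighted_sup alpha Lambda f)%E.

End small_fock.

(* Main.v *)
(* Idea.  An entire function [f] of the space has Taylor coefficients bounded by
   a multiple of [exp (- k^2 / (4 alpha))], so in the variable [t = log |z|] the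
   monomial [z^k] lives near [t = k / (2 alpha)]; this reduces both halves to
   finite sums.  (i) Interpolate [f] at points of [Lambda] in an annulus around
   [z0] by the monomials [z^k] whose number equals that of the nodes: as there are
   more than [2 alpha] nodes per unit of [t], the Gaussian decay beats the growth
   of the Lagrange basis, and the remaining monomials contribute at most
   [||f|| / 4] to [|f(z0)| e^{-phi(z0)}].  (ii) A Bernstein-type inequality
   allows to thin [Lambda] out to a [d_rho]-separated set that still samples
   polynomials; if it had fewer than [c log s] points, [c < 2 alpha], in some
   far annulus [A(r, s r)], then [z^m] times the polynomial vanishing at these
   points, with a suitable [m], would contradict the coefficient bound, because
   its lowest and highest coefficients are too large for its values on the rest
   of the set.  The coefficient bound rests on Goursat's lemma, proved for
   [f o exp] on rectangles, where the integral around an exceptional point is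
   controlled by a product of increments of square roots. *)

(* The quantitative core is one completed square: for [x = log |z| >= 0], a monomial with
   coefficient [exp (- k^2 / (4 alpha))] has weighted size [exp (- (k - 2 alpha x)^2 / (4 alpha))].
   In (i), [J] blocks of [N] nodes, each of logarithmic length [S], push the first degree that is
   not reproduced about [J N] away from [2 alpha x]. This gains [J^2 N^2 / (4 alpha)] in the
   exponent, while the logarithmic distances of the nodes cost [N S J^2 / 2]; the gain wins exactly
   when [N > 2 alpha S]. The separation constant enters only through terms linear in [J]. In (ii), a
   deficit of points keeps both extreme degrees at distance of order [S = log s] from [2 alpha x] on
   their circles, so a Gaussian in [S] faces only a factor [2^n] with [n] of order [S]. In both
   halves a small multiple of the norm is absorbed, which is legitimate because that norm is finite
   beforehand. The obstacle on the analytic side is that [f] is only assumed differentiable at each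
   point: its difference quotient at [z] is merely continuous there, hence the exceptional point in
   Goursat's lemma. *)
Require Import Defs.
From mathcomp Require Import all_boot all_order all_algebra.
From mathcomp Require Import all_classical all_reals all_analysis.
From mathcomp Require Import finmap complex ring lra.
Set Implicit Arguments.
Unset Strict Implicit.
Unset Printing Implicit Defensive.
Import Order.TTheory GRing.Theory Num.Theory.
Import numFieldNormedType.Exports.
Import ComplexField.Normc.
Local Open Scope classical_set_scope.
Local Open Scope ring_scope.
Local Open Scope complex_scope.
Local Notation Re := complex.Re.
Local Notation Im := complex.Im.

(** * Goursat's lemma for closed forms on a rectangle *)

Section goursat.
Variable R : realType.
Implicit Types (a b c d x y p q e : R).

Lemma nested_intervals (u v : nat -> R) :
  {homo u : m n / (m <= n)%N >-> m <= n} ->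
  {homo v : m n / (m <= n)%N >-> n <= m} ->
  (forall n, u n <= v n) -> exists p, forall n, u n <= p <= v n.
Proof.
move=> ui vd uv.
have uv' m n : u m <= v n.
  apply: le_trans (le_trans (uv (maxn m n)) _).
    exact: ui (leq_maxl _ _).
  exact: vd (leq_maxr _ _).
exists (sup (range u)) => n; apply/andP; split.
  apply: ub_le_sup; last by exists n.
  by exists (v 0) => _ [m _ <-].
apply: ge_sup; first by exists (u 0), 0.
by move=> _ [m _ <-].
Qed.

Lemma mvt_le (F f : R -> R) a b M : a <= b ->
  (forall x, is_derive x 1 F (f x)) ->
  (forall x, a <= x <= b -> `|f x| <= M) -> `|F b - F a| <= M * (b - a).
Proof.
move=> ab dF fM.
have [|x xab ->] := @MVT_segment _ F f a b ab (fun x _ => dF x).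
  by apply: derivable_within_continuous => x _; exact: ex_derive.
rewrite normrM [X in _ * X]ger0_norm ?subr_ge0// ler_wpM2r ?subr_ge0//.
by apply: fM; rewrite in_itv in xab.
Qed.

(** Compactness by quartering: a rectangle on which [P] fails has a quarter on which it fails, and
    these quarters shrink to a point contradicting the local hypothesis. Quartering keeps the
    proportions, so the local hypothesis only concerns rectangles similar to the original one. *)
Lemma bisection (P : R -> R -> R -> R -> Prop) a b c d : a < b -> c < d ->
  (forall a b c d, a < b -> c < d ->
     P a ((a + b) / 2) c ((c + d) / 2) -> P ((a + b) / 2) b c ((c + d) / 2) ->
     P a ((a + b) / 2) ((c + d) / 2) d -> P ((a + b) / 2) b ((c + d) / 2) d ->
     P a b c d) ->
  (forall p q, a <= p <= b -> c <= q <= d ->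
     exists2 e, 0 < e & forall a' b' c' d', a' < b' -> c' < d' ->
       a' <= p <= b' -> c' <= q <= d' ->
       (b' - a') * (d - c) = (d' - c') * (b - a) ->
       b' - a' < e -> d' - c' < e -> P a' b' c' d') ->
  P a b c d.
Proof.
move=> ab cd P4 Ploc; apply: contrapT => nP.
pose next (s : R * R * R * R) : R * R * R * R :=
  let: (a, b, c, d) := s in
  let m := (a + b) / 2 in let n := (c + d) / 2 in
  if ~~ `[< P a m c n >] then (a, m, c, n) else
  if ~~ `[< P m b c n >] then (m, b, c, n) else
  if ~~ `[< P a m n d >] then (a, m, n, d) else (m, b, n, d).
pose s n := iter n next (a, b, c, d).
pose u n := (s n).1.1.1; pose v n := (s n).1.1.2.
pose w n := (s n).1.2; pose t n := (s n).2.
have inv n : [/\ ~ P (u n) (v n) (w n) (t n), v n - u n = (b - a) / 2 ^+ n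
    & t n - w n = (d - c) / 2 ^+ n].
  elim: n => [|n]; first by rewrite /u /v /w /t /= expr0 !divr1.
  rewrite /u /v /w /t /=; case: (s n) => [[[a1 b1] c1] d1] /= [nP1 E1 E2].
  have lt2 x : 0 < x -> 0 < x / 2 ^+ n by move=> x0; rewrite divr_gt0// exprn_gt0.
  have ab1 : a1 < b1 by rewrite -subr_gt0 E1 lt2// subr_gt0.
  have cd1 : c1 < d1 by rewrite -subr_gt0 E2 lt2// subr_gt0.
  have F : forall x, x / 2 ^+ n.+1 = x / 2 ^+ n / 2.
    by move=> x; rewrite exprSr invfM mulrA.
  rewrite !F -E1 -E2.
  case: asboolP => h1 /=; last by split => //; lra.
  case: asboolP => h2 /=; last by split => //; lra.
  case: asboolP => h3 /=; last by split => //; lra.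
  split; [|lra|lra].
  by move=> h4; apply: nP1; exact: P4.
have uv n : u n < v n.
  by have [_ E _] := inv n; rewrite -subr_gt0 E divr_gt0 ?exprn_gt0 ?subr_gt0.
have wt n : w n < t n.
  by have [_ _ E] := inv n; rewrite -subr_gt0 E divr_gt0 ?exprn_gt0 ?subr_gt0.
have mono n : [/\ u n <= u n.+1, v n.+1 <= v n, w n <= w n.+1 & t n.+1 <= t n].
  have := uv n; have := wt n.
  rewrite /u /v /w /t /=; case: (s n) => [[[a1 b1] c1] d1] /= h1 h2.
  by case: ifP => _ /=; [split; lra|case: ifP => _ /=;
    [split; lra|case: ifP => _ /=; split; lra]].
have [p hp] : exists p, forall n, u n <= p <= v n.
  apply: nested_intervals => [||n]; last exact: ltW.
  - by apply: homo_leq => [//|y x z|n]; [exact: le_trans|case: (mono n)].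
  - apply: (@homo_leq _ v (fun x y => y <= x)) => [//|y x z xy yz|n].
      exact: le_trans yz xy.
    by case: (mono n).
have [q hq] : exists q, forall n, w n <= q <= t n.
  apply: nested_intervals => [||n]; last exact: ltW.
  - by apply: homo_leq => [//|y x z|n]; [exact: le_trans|case: (mono n)].
  - apply: (@homo_leq _ t (fun x y => y <= x)) => [//|y x z xy yz|n].
      exact: le_trans yz xy.
    by case: (mono n).
have [e e0 He] := Ploc p q (hp 0) (hq 0).
have half M : exists N, forall n, (N <= n)%N -> M / 2 ^+ n < e.
  exists (Num.bound (M / e)) => n Nn.
  rewrite ltr_pdivrMr ?exprn_gt0// mulrC -ltr_pdivrMr//.
  apply: le_lt_trans (ler_norm _) _.
  apply: lt_le_trans (archi_boundP (normr_ge0 _)) _.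
  have : ((Num.bound `|M / e|)%:R <= n%:R :> R).
    rewrite ler_nat; apply: leq_trans Nn.
    by rewrite /Num.bound normr_id.
  move=> /le_trans; apply.
  by rewrite -natrX ler_nat ltnW// ltn_expl.
have [N1 H1] := half (b - a); have [N2 H2] := half (d - c).
pose n := maxn N1 N2.
have [nPn E1 E2] := inv n; apply: nPn; apply: He => //.
- by rewrite E1 E2; ring.
- by rewrite E1 H1// leq_maxl.
- by rewrite E2 H2// leq_maxr.
Qed.

End goursat.

Section rectangle.
Variable R : realType.
Implicit Types (a b c d x y p q e : R).

Lemma sqrtD_le x y : 0 <= x -> 0 <= y ->
  Num.sqrt (x + y) <= Num.sqrt x + Num.sqrt y.
Proof.
move=> x0 y0.
rewrite -(@ler_pXn2r _ 2)// ?nnegrE ?addr_ge0 ?sqrtr_ge0// sqrrD !sqr_sqrtr ?addr_ge0//.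
have := mulr_ge0 (sqrtr_ge0 x) (sqrtr_ge0 y); lra.
Qed.

(* Around a square of side [h] containing a mere point of continuity the integral
   is only [o(h)], which the area does not control.  The product of the increments
   of two functions [sqrt_jump] is additive under subdivision and at least [h]. *)
Definition sqrt_jump p x : R := Num.sqrt (x - p) - Num.sqrt (p - x).

Lemma sqrt_jump_le p x y : x <= y -> sqrt_jump p x <= sqrt_jump p y.
Proof. by move=> xy; rewrite lerB// ler_wsqrtr// ?lerB// lerD2r. Qed.

Lemma sqrt_jump_ge p a b : a <= p <= b ->
  Num.sqrt (b - a) <= sqrt_jump p b - sqrt_jump p a.
Proof.
move=> /andP[ap pb]; rewrite /sqrt_jump.
rewrite (@ler0_sqrtr _ (p - b)) ?subr_le0//.
rewrite (@ler0_sqrtr _ (a - p)) ?subr_le0//.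
have -> : b - a = (b - p) + (p - a) by ring.
by rewrite (le_trans (sqrtD_le _ _)) ?subr_ge0//; lra.
Qed.

(* Closedness is the common coefficient [P2] of the two expansions. *)
Definition closed_at (P Q : R -> R -> R) p q := exists P1 P2 Q2 : R,
  forall e, 0 < e -> exists2 d, 0 < d & forall x y, `|x - p| < d -> `|y - q| < d ->
    `|P x y - (P p q + P1 * (x - p) + P2 * (y - q))| <= e * (`|x - p| + `|y - q|) /\
    `|Q x y - (Q p q + P2 * (x - p) + Q2 * (y - q))| <= e * (`|x - p| + `|y - q|).

(** The mean value inequality for [F] minus a primitive of the affine function. The case [v = 0]
    serves at the point of mere continuity. *)
Lemma affine_primitive (F f : R -> R) a b u v p e : a <= b ->
  (forall x, is_derive x 1 F (f x)) ->
  (forall x, a <= x <= b -> `|f x - (u + v * (x - p))| <= e) ->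
  `|F b - F a - (u * (b - a) + v * ((b - p) ^+ 2 - (a - p) ^+ 2) / 2)| <= e * (b - a).
Proof.
move=> ab dF fe.
pose G x := F x - (u * x + v / 2 * (x - p) ^+ 2).
have dG x : is_derive x 1 G (f x - (u + v * (x - p))).
  have dFx := dF x; rewrite /G.
  apply: is_derive_eq; rewrite /GRing.scale/=.
  by congr (_ - _); field.
have := mvt_le ab dG fe; congr (_ <= _); congr `| _ |.
by rewrite /G; field.
Qed.

(** The boundary integral [I] of [P dx + Q dy] and the gauge [M], area plus a product of increments
    of [sqrt_jump], are both additive under quartering. So [|I| <= e M] need only be checked on
    small rectangles around one point, and [e] is arbitrary. *)
Lemma rectangle_closed (P Q A B : R -> R -> R) (p0 q0 : R) a b c d :
  a < b -> c < d ->
  (forall x y, is_derive x 1 (A ^~ y) (P x y)) ->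
  (forall x y, is_derive y 1 (B x) (Q x y)) ->
  (forall e, 0 < e -> exists2 d, 0 < d & forall x y, `|x - p0| < d -> `|y - q0| < d ->
     `|P x y - P p0 q0| <= e /\ `|Q x y - Q p0 q0| <= e) ->
  (forall p q, a <= p <= b -> c <= q <= d -> (p, q) <> (p0, q0) ->
     closed_at P Q p q) ->
  (A b c - A a c) - (A b d - A a d) + (B b d - B b c) - (B a d - B a c) = 0.
Proof.
move=> ab cd hA hB cont0 clos.
pose I a b c d := (A b c - A a c) - (A b d - A a d) + (B b d - B b c) - (B a d - B a c).
pose M a b c d := (b - a) * (d - c) +
  (sqrt_jump p0 b - sqrt_jump p0 a) * (sqrt_jump q0 d - sqrt_jump q0 c).
have M0 : 0 < M a b c d.
  rewrite ltr_pwDl// ?mulr_gt0 ?subr_gt0// mulr_ge0// subr_ge0 sqrt_jump_le// ltW//.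
suff H e : 0 < e -> `|I a b c d| <= e * M a b c d.
  apply/eqP; rewrite -normr_le0; apply/ler_addgt0Pr => e e0; rewrite add0r.
  have := H (e / M a b c d); rewrite divfK ?gt_eqF//; apply.
  by rewrite divr_gt0.
move=> e0; apply: (@bisection R (fun a b c d => `|I a b c d| <= e * M a b c d)) => //.
  move=> a1 b1 c1 d1 _ _; set m := (_ + _) / 2; set n := (_ + _) / 2.
  move=> h1 h2 h3 h4.
  have -> : I a1 b1 c1 d1 = I a1 m c1 n + I m b1 c1 n + I a1 m n d1 + I m b1 n d1.
    by rewrite /I; ring.
  have -> : M a1 b1 c1 d1 = M a1 m c1 n + M m b1 c1 n + M a1 m n d1 + M m b1 n d1.
    by rewrite /M; ring.
  move: h1 h2 h3 h4.
  move: (I a1 m c1 n) (I m b1 c1 n) (I a1 m n d1) (I m b1 n d1) => i1 i2 i3 i4.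
  move: (M a1 m c1 n) (M m b1 c1 n) (M a1 m n d1) (M m b1 n d1) => m1 m2 m3 m4.
  by rewrite !ler_norml; lra.
move=> p q hp hq.
pose k := (d - c) / (b - a).
have k0 : 0 < k by rewrite divr_gt0 ?subr_gt0.
have kE a1 b1 c1 d1 : (b1 - a1) * (d - c) = (d1 - c1) * (b - a) -> d1 - c1 = k * (b1 - a1).
  by move=> E; rewrite /k mulrAC mulrC [_ * (b1 - a1)]mulrC E; field; lra.
have [[-> ->]|npq] := pselect ((p, q) = (p0, q0)).
  (* With [k] the ratio of height to width, [g] times the perimeter is the geometric mean of the
     sides, which [sqrt_jump_ge] bounds by the product of increments in [M]. *)
  pose g := Num.sqrt k / (2 + 2 * k).
  have g0 : 0 < g by rewrite divr_gt0 ?sqrtr_gt0//; lra.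
  have [dl dl0 Hd] := cont0 (e * g) (mulr_gt0 e0 g0).
  exists dl => // a1 b1 c1 d1 ab1 cd1 /andP[ap pb] /andP[cq qd] E bad dcd.
  have {}E := kE _ _ _ _ E.
  have P1 y : c1 <= y <= d1 ->
      `|A b1 y - A a1 y - P p0 q0 * (b1 - a1)| <= e * g * (b1 - a1).
    move=> /andP[cy yd].
    have := @affine_primitive (A ^~ y) (P ^~ y) a1 b1 (P p0 q0) 0 p0 (e * g).
    rewrite mul0r mul0r addr0; apply => //; first exact: ltW.
    move=> x /andP[ax xb]; rewrite mul0r addr0.
    apply: (Hd x y _ _).1; rewrite ltr_norml; clear -ap pb cq qd ax xb cy yd bad dcd; lra.
  have Q1 x : a1 <= x <= b1 ->
      `|B x d1 - B x c1 - Q p0 q0 * (d1 - c1)| <= e * g * (d1 - c1).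
    move=> /andP[cy yd].
    have := @affine_primitive (B x) (Q x) c1 d1 (Q p0 q0) 0 p0 (e * g).
    rewrite mul0r mul0r addr0; apply => //; first exact: ltW.
    move=> y /andP[ax xb]; rewrite mul0r addr0.
    apply: (Hd x y _ _).2; rewrite ltr_norml; clear -ap pb cq qd ax xb cy yd bad dcd; lra.
  have := P1 c1; have := P1 d1; have := Q1 a1; have := Q1 b1.
  rewrite !lexx (ltW ab1) (ltW cd1) => /(_ isT) h1 /(_ isT) h2 /(_ isT) h3 /(_ isT) h4.
  have S : Num.sqrt (b1 - a1) * Num.sqrt (d1 - c1) <=
     (sqrt_jump p0 b1 - sqrt_jump p0 a1) * (sqrt_jump q0 d1 - sqrt_jump q0 c1).
    by apply: ler_pM; rewrite ?sqrtr_ge0// sqrt_jump_ge// ?ap ?cq.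
  have SE : Num.sqrt (b1 - a1) * Num.sqrt (d1 - c1) = g * (2 * (b1 - a1) + 2 * (d1 - c1)).
    rewrite E sqrtrM ?ltW// mulrCA -expr2 sqr_sqrtr ?subr_ge0 ?ltW// /g.
    by field; lra.
  apply: (@le_trans _ _ (e * (g * (2 * (b1 - a1) + 2 * (d1 - c1))))).
    move: h1 h2 h3 h4; rewrite /I !ler_norml; clear; lra.
  rewrite ler_pM2l// -SE (le_trans S)// lerDr mulr_ge0// subr_ge0 ltW//.
have [P1 [P2 [Q2 H]]] := clos p q hp hq npq.
(* The affine parts cancel around the rectangle because they share [P2]. The remainders on the four
   sides add up to [2 e g] times the square of the half-perimeter, which for this [g] is [e] times
   the area. *)
pose g := k / (2 * (1 + k) ^+ 2).
have k1 : 1 + k != 0 by lra.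
have g0 : 0 < g by rewrite divr_gt0// mulr_gt0// exprn_gt0//; lra.
have [dl dl0 Hd] := H (e * g) (mulr_gt0 e0 g0).
exists dl => // a1 b1 c1 d1 ab1 cd1 /andP[ap pb] /andP[cq qd] E bad dcd.
have {}E := kE _ _ _ _ E.
have Hd' x y : a1 <= x <= b1 -> c1 <= y <= d1 ->
    `|P x y - (P p q + P1 * (x - p) + P2 * (y - q))| <= e * g * ((b1 - a1) + (d1 - c1)) /\
    `|Q x y - (Q p q + P2 * (x - p) + Q2 * (y - q))| <= e * g * ((b1 - a1) + (d1 - c1)).
  move=> /andP[ax xb] /andP[cy yd].
  have [h3 h4] : `|x - p| <= b1 - a1 /\ `|y - q| <= d1 - c1.
    by rewrite !ler_norml; clear -ap pb cq qd ax xb cy yd; split; lra.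
  have [||h1 h2] := Hd x y; [exact: le_lt_trans h3 bad|exact: le_lt_trans h4 dcd|].
  have K : e * g * (`|x - p| + `|y - q|) <= e * g * ((b1 - a1) + (d1 - c1)).
    apply: ler_wpM2l; first by apply: mulr_ge0; exact: ltW.
    exact: lerD.
  by split; [apply: le_trans h1 K|apply: le_trans h2 K].
have PA y : c1 <= y <= d1 -> `|A b1 y - A a1 y - ((P p q + P2 * (y - q)) * (b1 - a1)
    + P1 * ((b1 - p) ^+ 2 - (a1 - p) ^+ 2) / 2)| <=
    e * g * ((b1 - a1) + (d1 - c1)) * (b1 - a1).
  move=> cyd; apply: (@affine_primitive (A ^~ y) (P ^~ y)) => //; first exact: ltW.
  move=> x axb; have [+ _] := Hd' x y axb cyd; congr (_ <= _); congr `| _ |; ring.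
have QB x : a1 <= x <= b1 -> `|B x d1 - B x c1 - ((Q p q + P2 * (x - p)) * (d1 - c1)
    + Q2 * ((d1 - q) ^+ 2 - (c1 - q) ^+ 2) / 2)| <=
    e * g * ((b1 - a1) + (d1 - c1)) * (d1 - c1).
  move=> axb; apply: (@affine_primitive (B x) (Q x)) => //; first exact: ltW.
  by move=> y cyd; have [_] := Hd' x y axb cyd.
have := PA c1; have := PA d1; have := QB a1; have := QB b1.
rewrite !lexx (ltW ab1) (ltW cd1) => /(_ isT) h1 /(_ isT) h2 /(_ isT) h3 /(_ isT) h4.
apply: (@le_trans _ _ (e * ((b1 - a1) * (d1 - c1)))); last first.
  rewrite ler_pM2l// lerDl mulr_ge0// subr_ge0 sqrt_jump_le// ltW//.
have -> : e * ((b1 - a1) * (d1 - c1)) =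
    2 * (e * g * ((b1 - a1) + (d1 - c1)) * (b1 - a1)) +
    2 * (e * g * ((b1 - a1) + (d1 - c1)) * (d1 - c1)).
  by rewrite E /g; field.
move: h1 h2 h3 h4.
set X := e * g * _ * (b1 - a1); set Y := e * g * _ * (d1 - c1).
rewrite /I !ler_norml => /andP[l1 u1] /andP[l2 u2] /andP[l3 u3] /andP[l4 u4].
clear -l1 u1 l2 u2 l3 u3 l4 u4; lra.
Qed.

End rectangle.

(** * Means of continuous functions over a period *)

Section mean.
Variable R : realType.
Implicit Types (u v : R -> R) (a b c x y M : R).
Notation mu := (@lebesgue_measure R).

Lemma mvt_cst (F f : R -> R) a b :
  (forall x, a <= x <= b -> is_derive x 1 F (f x)) ->
  (forall x, a <= x <= b -> f x = 0) -> a <= b -> F a = F b.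
Proof.
move=> dF f0 ab; have [||x] := @MVT_segment _ F f a b ab.
- by move=> x; rewrite in_itv/= => /andP[ax xb]; apply: dF; rewrite !ltW.
- apply: derivable_within_continuous => x; rewrite in_itv/= => xab.
  by have dFx := dF x xab; exact: ex_derive.
by rewrite in_itv/= => /f0 -> /eqP; rewrite mul0r subr_eq0 => /eqP.
Qed.

Lemma primitive_exists u : continuous u ->
  exists U : R -> R, forall x, is_derive x 1 U (u x).
Proof.
move=> cu.
(* The fundamental theorem yields a primitive only to the right of a base point. The primitives
   based at [- n] are normalised at [0], where they then agree, and glued. *)
pose F (n : nat) x := (\int[mu]_(t in `[- n%:R, x]) u t)%R.
have dF n x : - n%:R < x -> is_derive x 1 (F n) (u x).
  move=> nx; have [||||d e] := @continuous_FTC1_closed R u (- n%:R) x (x + 1).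
  - by rewrite ltrDl.
  - apply: continuous_compact_integrable; first exact: segment_compact.
    exact: continuous_subspaceT.
  - exact: nx.
  - exact: cu.
  by apply: (DeriveDef d); rewrite -derive1E; exact: e.
pose G n x := F n x - F n 0.
have dG n x : - n%:R < x -> is_derive x 1 (G n) (u x).
  move=> nx; have dFx := dF n x nx.
  by apply: is_derive_eq; rewrite subr0.
have GG n m x : (0 < n)%N -> (0 < m)%N -> - n%:R < x -> - m%:R < x -> G n x = G m x.
  move=> n0 m0 nx mx; apply/eqP; rewrite -subr_eq0; apply/eqP.
  have <- : G n 0 - G m 0 = 0 by rewrite /G !subrr.
  have nR k : (0 < k)%N -> - k%:R < 0 :> R by rewrite oppr_lt0 ltr0n.
  have dH (z : R) : - n%:R < z -> - m%:R < z -> is_derive z 1 (fun z : R => G n z - G m z) 0.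
    move=> nz mz; have d1 := dG n z nz; have d2 := dG m z mz.
    by apply: is_derive_eq; rewrite subrr.
  have [x0|x0] := leP 0 x.
    apply/esym; apply: (@mvt_cst (fun z : R => G n z - G m z) (fun=> 0)) => // z /andP[z0 _].
    by apply: dH; apply: lt_le_trans z0; exact: nR.
  apply: (@mvt_cst (fun z : R => G n z - G m z) (fun=> 0)) => //; last exact: ltW.
  by move=> z /andP[xz _]; apply: dH; apply: lt_le_trans xz.
pose N (x : R) := (Num.bound `|x|).+2.
have NP x : - (N x)%:R < x - 1.
  have : `|x| < (Num.bound `|x|)%:R by rewrite archi_boundP.
  rewrite ltr_norml => /andP[+ _].
  by rewrite /N -!natr1; lra.
exists (fun x => G (N x) x) => x.
have dx : is_derive x 1 (G (N x)) (u x).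
  by apply: dG; apply: lt_trans (NP x) _; rewrite ltrBlDr ltrDl.
apply: (near_eq_is_derive _ dx).
near=> y.
apply: GG => //; last by apply: lt_trans (NP y) _; rewrite ltrBlDr ltrDl.
apply: lt_trans (NP x) _.
near: y; apply: lt_nbhsr; rewrite ltrBlDr ltrDl//.
Unshelve. all: by end_near.
Qed.

Definition primitive u : R -> R :=
  xget (fun=> 0) [set U | forall x, is_derive x 1 U (u x)].

Lemma is_derive_primitive u : continuous u -> forall x, is_derive x 1 (primitive u) (u x).
Proof. by move=> /primitive_exists[U dU]; rewrite /primitive; case: xgetP => [V _ //|/(_ U)]. Qed.

(** For continuous [u] this is the normalised integral over a period. Through primitives, its
    properties reduce to the mean value theorem. *)
Definition mean u : R := (primitive u (pi *+ 2) - primitive u 0) / (pi *+ 2).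

Lemma mean_primitive u U : (forall x, is_derive x 1 U (u x)) -> continuous u ->
  mean u = (U (pi *+ 2) - U 0) / (pi *+ 2).
Proof.
move=> dU cu; congr (_ / _).
have : U 0 - primitive u 0 = U (pi *+ 2) - primitive u (pi *+ 2).
  apply: (@mvt_cst (fun x => U x - primitive u x) (fun=> 0)) => [x _|//|].
    have d1 := dU x; have d2 := is_derive_primitive cu x.
    by apply: is_derive_eq; rewrite subrr.
  by rewrite mulrn_wge0// pi_ge0.
lra.
Qed.

Lemma mean_shift u c : continuous u -> (forall x, u (x + pi *+ 2) = u x) ->
  mean u = (primitive u (c + pi *+ 2) - primitive u c) / (pi *+ 2).
Proof.
move=> cu per; congr (_ / _).
pose D x := primitive u (x + pi *+ 2) - primitive u x.
have dD x : is_derive x 1 D 0.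
  have d1 := is_derive_primitive cu x.
  have d2 := is_derive_primitive cu (x + pi *+ 2).
  have d3 : is_derive x 1 (primitive u \o (fun y : R => y + pi *+ 2)) (u x).
    have d4 : is_derive x 1 (fun y : R => y + pi *+ 2) 1.
      by apply: is_derive_eq; rewrite addr0.
    by apply: is_derive_eq; rewrite per /GRing.scale/= ?mul1r ?mulr1.
  have := is_deriveB d3 d1; rewrite subrr; exact.
have -> : primitive u (pi *+ 2) - primitive u 0 = D 0 by rewrite /D add0r.
have [c0|c0] := leP 0 c.
  exact: (@mvt_cst D (fun=> 0)).
by apply/esym/(@mvt_cst D (fun=> 0)) => //; exact: ltW.
Qed.

Lemma meanD u v : continuous u -> continuous v ->
  mean (fun x => u x + v x) = mean u + mean v.
Proof.
move=> cu cv.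
have dU (x : R) :
    is_derive x 1 (fun x => primitive u x + primitive v x) (u x + v x).
  have d1 := is_derive_primitive cu x; have d2 := is_derive_primitive cv x.
  exact: is_derive_eq.
rewrite (mean_primitive dU); first by rewrite /mean; lra.
by move=> x; apply: cvgD; [exact: cu|exact: cv].
Qed.

Lemma meanZ u c : continuous u -> mean (fun x => c * u x) = c * mean u.
Proof.
move=> cu.
have dU (x : R) : is_derive x 1 (fun x => c * primitive u x) (c * u x).
  by have d1 := is_derive_primitive cu x; apply: is_derive_eq.
rewrite (mean_primitive dU); first by rewrite /mean; lra.
by move=> x; apply: cvgM; [exact: cvg_cst|exact: cu].
Qed.

Lemma mean_cst c : mean (fun=> c) = c.
Proof.
have dU (x : R) : is_derive x 1 (fun x => c * x) c.
  by apply: is_derive_eq; rewrite /GRing.scale/= mulr1.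
rewrite (mean_primitive dU); last by move=> x; exact: cvg_cst.
by have := pi_gt0 R; move=> h; field; lra.
Qed.

Lemma mean_norm_le u M : continuous u -> (forall x, `|u x| <= M) -> `|mean u| <= M.
Proof.
move=> cu uM; have pi0 := pi_gt0 R.
have := @mvt_le R (primitive u) u 0 (pi *+ 2) M _ (is_derive_primitive cu) (fun x _ => uM x).
rewrite subr0 => /(_ _)/wrap[|h]; first by lra.
by rewrite normrM normfV [X in _ / X]ger0_norm ?ler_pdivrMr//; lra.
Qed.

End mean.

(** * Complex differentiability and polar coordinates *)

Section normc_lemmas.
Variable R : realType.
Implicit Types (z w : R[i]) (x y a b e : R).

Lemma normcE z : `|z| = (normc z)%:C. Proof. by []. Qed.

Lemma normc_ge0 z : 0 <= normc z.
Proof. by case: z => a b; exact: sqrtr_ge0. Qed.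

Lemma normcN z : normc (- z) = normc z.
Proof. by apply: (@complexI R); exact: (@normrN R[i] R[i]). Qed.

Lemma normcD_le z w : normc (z + w) <= normc z + normc w.
Proof. by rewrite -lecR rmorphD/=; exact: (@ler_normD _ R[i]). Qed.

Lemma normcB z w : normc (z - w) = normc (w - z).
Proof. by rewrite -normcN opprB. Qed.

Lemma normcB_le z w : normc (z - w) <= normc z + normc w.
Proof. by rewrite -(normcN w) normcD_le. Qed.

Lemma normc_lerB z w : normc z - normc w <= normc (z - w).
Proof. by rewrite lerBlDr (le_trans _ (normcD_le _ _))// subrK. Qed.

Lemma normc_eq0 z : (normc z == 0) = (z == 0).
Proof. by apply/eqP/eqP => [/eq0_normc//|->]; exact: normc0. Qed.

Lemma normc_gt0 z : (0 < normc z) = (z != 0).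
Proof. by rewrite lt0r normc_ge0 normc_eq0 andbT. Qed.

Lemma normcX z n : normc (z ^+ n) = normc z ^+ n.
Proof. by elim: n => [|n IH]; rewrite ?expr0 ?normc1// !exprS normcM IH. Qed.

Lemma normc_sum (I : Type) (r : seq I) (P : pred I) (F : I -> R[i]) :
  normc (\sum_(i <- r | P i) F i) <= \sum_(i <- r | P i) normc (F i).
Proof.
elim/big_ind2: _ => [|x y z w h1 h2|//]; first by rewrite normc0.
by rewrite (le_trans (normcD_le _ _))// lerD.
Qed.

Lemma normc_prod (I : Type) (r : seq I) (P : pred I) (F : I -> R[i]) :
  normc (\prod_(i <- r | P i) F i) = \prod_(i <- r | P i) normc (F i).
Proof.
elim/big_ind2: _ => [|x y z w <- <-|//]; first by rewrite normc1.
exact: normcM.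
Qed.

Lemma normc_le_ReIm a b : normc (a +i* b) <= `|a| + `|b|.
Proof.
rewrite -(@ler_pXn2r _ 2)// ?nnegrE ?addr_ge0 ?normc_ge0//.
rewrite sqr_sqrtr ?addr_ge0 ?sqr_ge0// sqrrD !real_normK ?num_real//.
have := mulr_ge0 (normr_ge0 a) (normr_ge0 b); lra.
Qed.

Lemma Re_le_normc z : `|Re z| <= normc z.
Proof.
case: z => a b /=; rewrite -sqrtr_sqr ler_wsqrtr// lerDl sqr_ge0//.
Qed.

Lemma Im_le_normc z : `|Im z| <= normc z.
Proof.
case: z => a b /=; rewrite -sqrtr_sqr ler_wsqrtr// lerDr sqr_ge0//.
Qed.

(** Complex differentiability with real radii and errors: the norm of [R[i]] takes values in [R[i]],
    which is inconvenient next to the real estimates on rectangles. *)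
Definition cdiff (f : R[i] -> R[i]) z := exists D : R[i], forall e, 0 < e ->
  exists2 d : R, 0 < d & forall w, normc (w - z) < d ->
    normc (f w - f z - D * (w - z)) <= e * normc (w - z).

Definition ccont (f : R[i] -> R[i]) z := forall e, 0 < e ->
  exists2 d : R, 0 < d & forall w, normc (w - z) < d -> normc (f w - f z) <= e.

Lemma derivable_cdiff (f : R[i] -> R[i]) z :
  derivable (f : R[i]^o -> R[i]^o) z 1 -> cdiff f z.
Proof.
rewrite /derivable => /cvg_ex[D /= /cvgrPdist_le H]; exists D => e e0.
have /H : (0 : R[i]) < e%:C by rewrite ltcR.
move=> -[[d dI] /= d0 Hd]; exists d.
  by move: d0; rewrite ltcE/= => /andP[].
move=> w wd; have [->|wz] := eqVneq w z.
  by rewrite !subrr mulr0 subrr normc0 mulr0.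
have wz0 : w - z != 0 by rewrite subr_eq0.
have := Hd (w - z); rewrite /ball_/= sub0r normrN => /(_ _ wz0)/wrap[].
  by rewrite normcE; move: d0; rewrite !ltcE/= => /andP[/eqP -> _]; rewrite eqxx.
rewrite /GRing.scale/= mulr1 subrK normcE lecR => h.
have -> : f w - f z - D * (w - z) =
    - ((D - (w - z)^-1 * (f w - f z)) * (w - z)) by field.
by rewrite normcN normcM ler_wpM2r ?normc_ge0.
Qed.

Lemma cdiff_ccont f z : cdiff f z -> ccont f z.
Proof.
move=> [D H] e e0; have [d d0 Hd] := H 1 ltr01.
pose k := normc D + 1; have k0 : 0 < k by rewrite ltr_wpDl ?normc_ge0.
exists (Num.min d (e / k)); first by rewrite lt_min d0 divr_gt0.
move=> w; rewrite lt_min => /andP[/Hd h1 h2].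
rewrite -(subrK (D * (w - z)) (f w - f z)) (le_trans (normcD_le _ _))//.
rewrite normcM; rewrite ltr_pdivlMr// /k in h2; lra.
Qed.

End normc_lemmas.

Section polar.
Variable R : realType.
Implicit Types (x y p q e : R) (z w : R[i]).

Lemma derive_approx (F : R -> R) p D : is_derive p 1 F D -> forall e, 0 < e ->
  exists2 d : R, 0 < d & forall x, `|x - p| < d -> `|F x - F p - D * (x - p)| <= e * `|x - p|.
Proof.
move=> [dF <-] e e0.
have dF' : h^-1 *: (F (h *: 1 + p) - F p) @[h --> 0^'] --> 'D_1 F p by exact: dF.
move/cvgrPdist_le/(_ e e0) : dF' => -[d /= d0 Hd]; exists d => // x xp.
have [->|xp0] := eqVneq x p.
  by rewrite !subrr mulr0 subrr normr0 mulr0.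
rewrite -subr_eq0 in xp0.
have := Hd (x - p); rewrite /ball_/= sub0r normrN => /(_ xp xp0).
rewrite /GRing.scale/= mulr1 subrK => h.
have -> : F x - F p - 'D_1 F p * (x - p) =
    - (('D_1 F p - (x - p)^-1 * (F x - F p)) * (x - p)) by field.
by rewrite normrN normrM ler_wpM2r.
Qed.

(* [polar x y] is [exp (x + i y)]. *)
Definition polar x y : R[i] := (expR x * cos y) +i* (expR x * sin y).

Lemma polarM x y p q : polar x y * polar p q = polar (x + p) (y + q).
Proof.
rewrite /polar expRD cosD sinD; apply/eqP; rewrite eq_complex/=.
by apply/andP; split; apply/eqP; ring.
Qed.

Lemma normc_polar x y : normc (polar x y) = expR x.
Proof.
by rewrite /polar /= !exprMn -mulrDr cos2Dsin2 mulr1 sqrtr_sqr ger0_norm//.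
Qed.

Lemma polar_neq0 x y : polar x y != 0.
Proof. by rewrite -normc_gt0 normc_polar expR_gt0. Qed.

Lemma polar2pi x y : polar x (y + pi *+ 2) = polar x y.
Proof. by rewrite /polar cosD2pi sinD2pi. Qed.

Lemma polar_exists z : z != 0 -> exists x y, z = polar x y.
Proof.
move=> z0; have n0 : 0 < normc z by rewrite normc_gt0.
pose c := Re z / normc z; pose s := Im z / normc z.
have cs : c ^+ 2 + s ^+ 2 = 1.
  rewrite /c /s !exprMn -mulrDl exprVn; apply/(canLR (mulfK _)).
    by rewrite expf_neq0// gt_eqF.
  rewrite mul1r; case: z z0 n0 @c @s => a b _ _ /=.
  by rewrite sqr_sqrtr ?addr_ge0 ?sqr_ge0.
have c1 : -1 <= c <= 1 by rewrite -ler_norml -(expr_le1 (n:=2))// real_normK ?num_real//; have := sqr_ge0 s; lra.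
have sa : sin (acos c) = `|s|.
  by rewrite sin_acos// -cs addrC addKr sqrtr_sqr.
have E y : cos y = c -> sin y = s -> z = polar (ln (normc z)) y.
  move=> cy sy; rewrite /polar cy sy lnK ?posrE//; apply/eqP; rewrite eq_complex/= /c /s.
  by apply/andP; split; apply/eqP; rewrite mulrC divfK// gt_eqF.
exists (ln (normc z)); have [s0|s0] := leP 0 s.
  by exists (acos c); apply: E; rewrite ?acosK ?in_itv//= sa ger0_norm.
exists (- acos c); apply: E; rewrite ?cosN ?sinN ?acosK ?in_itv//= sa ltr0_norm//.
by rewrite opprK.
Qed.

Lemma polar_inj x y p q : `|y - q| <= pi -> polar x y = polar p q -> (x, y) = (p, q).
Proof.
move=> yq E.
have xp : x = p by apply: expR_inj; rewrite -(normc_polar x y) E normc_polar.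
rewrite {}xp in E *; congr pair.
have ep : expR p != 0 by rewrite gt_eqF ?expR_gt0.
move: E; rewrite /polar => -[/(mulfI ep) cE /(mulfI ep) sE].
have : cos `|y - q| = cos 0.
  by rewrite cos_norm cosB cE sE -!expr2 cos2Dsin2 cos0.
move=> /cos_inj; rewrite !in_itv/= normr_ge0 yq lexx pi_ge0 => /(_ isT isT)/eqP.
by rewrite normr_eq0 subr_eq0 => /eqP.
Qed.

Lemma polar_diff0 e : 0 < e -> exists2 d : R, 0 < d & forall x y, `|x| < d -> `|y| < d ->
  normc (polar x y - 1 - (x +i* y)) <= e * (`|x| + `|y|).
Proof.
(* The errors of the two components will add up to at most [g |x| + 8 g |y|]; the cap at [1] keeps
   [expR x] below [3]. *)
move=> e0; pose g := Num.min e 1 / 8.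
have eg : 0 < g by rewrite divr_gt0// lt_min e0 ltr01.
have [ge g1] : g * 8 <= e /\ g * 8 <= 1.
  by rewrite /g divfK// !ge_min !lexx orbT.
have [d1 d10 H1] := derive_approx (is_derive_expR (0 : R)) eg.
have [d2 d20 H2] := derive_approx (is_derive_cos (0 : R)) eg.
have [d3 d30 H3] := derive_approx (is_derive_sin (0 : R)) eg.
exists (Num.min (Num.min d1 d2) (Num.min d3 g)).
  by rewrite !lt_min d10 d20 d30 eg.
move=> x y; rewrite !lt_min => /andP[/andP[xd1 _] /andP[_ xg]].
move=> /andP[/andP[_ yd2] /andP[yd3 yg]].
have := H1 x; have := H2 y; have := H3 y; rewrite !subr0 => /(_ yd3) h3 /(_ yd2) h2 /(_ xd1) h1.
rewrite expR0 mul1r in h1; rewrite cos0 sin0 oppr0 mul0r subr0 in h2.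
rewrite sin0 cos0 mul1r subr0 in h3.
have x0 := normr_ge0 x; have y0 := normr_ge0 y.
have e1 : `|expR x - 1| <= 2 * `|x|.
  rewrite -(subrK x (expR x - 1)) (le_trans (ler_normD _ _))//.
  have : g * `|x| <= 1 * `|x| by rewrite ler_wpM2r//; lra.
  lra.
have e3 : expR x <= 3 by move: e1; rewrite ler_norml; lra.
have ex0 := expR_ge0 x.
have -> : polar x y - 1 - (x +i* y) =
    (expR x * (cos y - 1) + (expR x - 1 - x)) +i* (expR x * (sin y - y) + y * (expR x - 1)).
  by apply/eqP; rewrite eq_complex/=; apply/andP; split; apply/eqP; ring.
apply: le_trans (normc_le_ReIm _ _) _.
have k1 : `|expR x * (cos y - 1) + (expR x - 1 - x)| <= 3 * (g * `|y|) + g * `|x|.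
  rewrite (le_trans (ler_normD _ _))// lerD// normrM (ger0_norm ex0).
  by rewrite ler_pM.
have k2 : `|expR x * (sin y - y) + y * (expR x - 1)| <= 3 * (g * `|y|) + `|y| * (2 * g).
  apply: le_trans (ler_normD _ _) _; apply: lerD; rewrite normrM.
    by rewrite (ger0_norm ex0) ler_pM.
  by rewrite ler_wpM2l// (le_trans e1)// ler_wpM2l// ltW.
apply: le_trans (lerD k1 k2) _.
have : g * 8 * (`|x| + `|y|) <= e * (`|x| + `|y|) by rewrite ler_wpM2r// addr_ge0.
have : 0 <= g * `|x| by rewrite mulr_ge0// ltW.
lra.
Qed.

Lemma polar_diff p q e : 0 < e ->
  exists2 d : R, 0 < d & forall x y, `|x - p| < d -> `|y - q| < d ->
  normc (polar x y - polar p q - polar p q * ((x - p) +i* (y - q))) <=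
  e * (`|x - p| + `|y - q|).
Proof.
move=> e0; have eg : 0 < e / expR p by rewrite divr_gt0 ?expR_gt0.
have [d d0 H] := polar_diff0 eg; exists d => // x y xd yd.
have {H} := H _ _ xd yd.
have -> : polar x y - polar p q - polar p q * ((x - p) +i* (y - q)) =
    polar p q * (polar (x - p) (y - q) - 1 - ((x - p) +i* (y - q))).
  have -> : polar x y = polar p q * polar (x - p) (y - q).
    by rewrite polarM ![_ + (_ - _)]addrC !subrK.
  by ring.
rewrite normcM normc_polar => H.
rewrite [leLHS]mulrC -ler_pdivlMr ?expR_gt0//.
by rewrite (le_trans H)// mulrAC.
Qed.

End polar.

(** * Means over circles *)

Section circle_mean.
Variable R : realType.
Implicit Types (x y p q e : R) (z w : R[i]) (f g : R[i] -> R[i]).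

Lemma polar_cont p q e : 0 < e ->
  exists2 d : R, 0 < d & forall x y, `|x - p| < d -> `|y - q| < d ->
  normc (polar x y - polar p q) <= (expR p + 1) * (`|x - p| + `|y - q|) /\
  normc (polar x y - polar p q) < e.
Proof.
move=> e0; have [d d0 H] := polar_diff p q (@ltr01 R).
have k0 : 0 < expR p + 1 by rewrite addr_gt0// expR_gt0.
exists (Num.min d (e / (2 * (expR p + 1)))).
  by rewrite lt_min d0 divr_gt0// mulr_gt0.
move=> x y; rewrite !lt_min => /andP[xd xe] /andP[yd ye].
have h : normc (polar x y - polar p q) <= (expR p + 1) * (`|x - p| + `|y - q|).
  rewrite -(subrK (polar p q * ((x - p) +i* (y - q))) (polar x y - polar p q)).
  rewrite (le_trans (normcD_le _ _))// normcM normc_polar.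
  have := H _ _ xd yd; have := normc_le_ReIm (x - p) (y - q).
  rewrite -(@ler_pM2l _ (expR p)) ?expR_gt0//; lra.
split=> //; apply: le_lt_trans h _.
move: xe ye; rewrite !ltr_pdivlMr ?mulr_gt0//; nra.
Qed.

Lemma cdiff_polar f p q : cdiff f (polar p q) -> exists E : R[i],
  forall e, 0 < e -> exists2 d : R, 0 < d &
  forall x y, `|x - p| < d -> `|y - q| < d ->
    normc (f (polar x y) - f (polar p q) - E * ((x - p) +i* (y - q))) <=
    e * (`|x - p| + `|y - q|).
Proof.
move=> [D H]; exists (D * polar p q) => e e0.
have k0 : 0 < expR p + 1 by rewrite addr_gt0// expR_gt0.
have D0 : 0 < normc D + 1 by rewrite ltr_wpDl ?normc_ge0.
have e1 : 0 < e / (2 * (expR p + 1)) by rewrite divr_gt0// mulr_gt0.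
have e2 : 0 < e / (2 * (normc D + 1)) by rewrite divr_gt0// mulr_gt0.
have [d1 d10 H1] := H _ e1.
have [d2 d20 H2] := polar_diff p q e2.
have [d3 d30 H3] := polar_cont p q d10.
exists (Num.min d2 d3); first by rewrite lt_min d20.
move=> x y; rewrite !lt_min => /andP[x2 x3] /andP[y2 y3].
have [h3 h4] := H3 _ _ x3 y3.
have {}h1 := H1 _ h4; have {}h2 := H2 _ _ x2 y2.
set T := `|x - p| + `|y - q| in h2 h3 *.
have T0 : 0 <= T by rewrite addr_ge0.
set W := (x - p) +i* (y - q) in h2 *.
have -> : f (polar x y) - f (polar p q) - D * polar p q * W =
   (f (polar x y) - f (polar p q) - D * (polar x y - polar p q)) +
   D * (polar x y - polar p q - polar p q * W) by ring.
rewrite (le_trans (normcD_le _ _))// normcM.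
have l1 : normc (f (polar x y) - f (polar p q) - D * (polar x y - polar p q)) <= e / 2 * T.
  apply: le_trans h1 _.
  have -> : e / 2 * T = e / (2 * (expR p + 1)) * ((expR p + 1) * T) by field; lra.
  by rewrite ler_wpM2l// ltW.
have l2 : normc D * normc (polar x y - polar p q - polar p q * W) <= e / 2 * T.
  have -> : e / 2 * T = (normc D + 1) * (e / (2 * (normc D + 1)) * T) by field; lra.
  by rewrite ler_pM ?normc_ge0// lerDl.
lra.
Qed.

Lemma continuous_eps (u : R -> R) x :
  (forall e, 0 < e -> exists2 d : R, 0 < d & forall y, `|y - x| < d -> `|u y - u x| <= e) ->
  {for x, continuous u}.
Proof.
move=> H; apply/cvgrPdist_le => e /H[d d0 Hd].
by exists d => // y /= yd; rewrite distrC Hd// distrC.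
Qed.

(* Closedness gives equal means on all circles: the two horizontal sides of
   the rectangle cancel by periodicity. *)
Lemma mean_invariant (P Q : R -> R -> R) p0 q0 c :
  (forall p q e, 0 < e -> exists2 d : R, 0 < d &
     forall x y, `|x - p| < d -> `|y - q| < d ->
     `|P x y - P p q| <= e /\ `|Q x y - Q p q| <= e) ->
  (forall x y, P x (y + pi *+ 2) = P x y) ->
  (forall x y, Q x (y + pi *+ 2) = Q x y) ->
  (forall p q, c <= q <= c + pi *+ 2 -> (p, q) <> (p0, q0) -> closed_at P Q p q) ->
  forall x1 x2, mean (Q x1) = mean (Q x2).
Proof.
move=> cont perP perQ clos.
have cP y : continuous (P ^~ y).
  move=> x; apply: continuous_eps => e /(cont x y)[d d0 H]; exists d => // x' /H H'.
  by have [] := H' y; rewrite ?subrr ?normr0.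
have cQ x : continuous (Q x).
  move=> y; apply: continuous_eps => e /(cont x y)[d d0 H]; exists d => // y'.
  by have := H x y'; rewrite subrr normr0 => /(_ d0) H' /H'[].
have lt x1 x2 : x1 < x2 -> mean (Q x1) = mean (Q x2).
  move=> x12; have pi0 := pi_gt0 R.
  have := @rectangle_closed R P Q (fun x y => primitive (P ^~ y) x)
    (fun x => primitive (Q x)) p0 q0 x1 x2 c (c + pi *+ 2) x12.
  rewrite ltrDl mulrn_wgt0// => /(_ isT) H.
  have {}H := H (fun x y => is_derive_primitive (cP y) x)
    (fun x y => is_derive_primitive (cQ x) y) (cont p0 q0) (fun p q _ => @clos p q).
  rewrite (mean_shift c (cQ x1) (perQ x1)) (mean_shift c (cQ x2) (perQ x2)).
  congr (_ / _); apply/esym/eqP; rewrite -subr_eq0; apply/eqP; rewrite -[RHS]H.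
  have -> : P ^~ (c + pi *+ 2) = P ^~ c by apply/funext => x; exact: perP.
  by ring.
move=> x1 x2; have [/lt//|/lt//|->//] := ltgtP x1 x2.
Qed.

Definition cmean (g : R -> R[i]) : R[i] :=
  mean (fun y => Re (g y)) +i* mean (fun y => Im (g y)).

Definition ccontR (g : R -> R[i]) :=
  continuous (fun y => Re (g y)) /\ continuous (fun y => Im (g y)).

Lemma ccontRD (g h : R -> R[i]) : ccontR g -> ccontR h -> ccontR (fun y => g y + h y).
Proof.
move=> [g1 g2] [h1 h2]; split => y.
- have -> : (fun y => Re (g y + h y)) = (fun y => Re (g y) + Re (h y)).
    by apply/funext => t; case: (g t) (h t) => [? ?] [].
  by apply: cvgD; [exact: g1|exact: h1].
- have -> : (fun y => Im (g y + h y)) = (fun y => Im (g y) + Im (h y)).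
    by apply/funext => t; case: (g t) (h t) => [? ?] [].
  by apply: cvgD; [exact: g2|exact: h2].
Qed.

Lemma ccontRZ (g : R -> R[i]) z : ccontR g -> ccontR (fun y => z * g y).
Proof.
case: z => a b [g1 g2]; split => y.
- have -> : (fun y => Re ((a +i* b) * g y)) = (fun y => a * Re (g y) + (- b) * Im (g y)).
    by apply/funext => t; case: (g t) => ? ? /=; ring.
  by apply: cvgD; apply: cvgM; [exact: cvg_cst|exact: g1|exact: cvg_cst|exact: g2].
- have -> : (fun y => Im ((a +i* b) * g y)) = (fun y => a * Im (g y) + b * Re (g y)).
    by apply/funext => t; case: (g t) => ? ? /=; ring.
  by apply: cvgD; apply: cvgM; [exact: cvg_cst|exact: g2|exact: cvg_cst|exact: g1].
Qed.

Lemma ccontR_cst z : ccontR (fun=> z).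
Proof. by split=> y; exact: cvg_cst. Qed.

Lemma cmeanD (g h : R -> R[i]) : ccontR g -> ccontR h ->
  cmean (fun y => g y + h y) = cmean g + cmean h.
Proof.
move=> [g1 g2] [h1 h2]; rewrite /cmean.
apply/eqP; rewrite eq_complex/= -!meanD//; apply/andP; split; apply/eqP; congr mean.
- by apply/funext => t; case: (g t) (h t) => [? ?] [].
- by apply/funext => t; case: (g t) (h t) => [? ?] [].
Qed.

Lemma cmeanZ (g : R -> R[i]) z : ccontR g -> cmean (fun y => z * g y) = z * cmean g.
Proof.
case: z => a b [g1 g2]; rewrite /cmean.
have cZ (u : R -> R) c : continuous u -> continuous (fun y => c * u y).
  by move=> cu y; apply: cvgM; [exact: cvg_cst|exact: cu].
apply/eqP; rewrite eq_complex/= -!mulNr -!meanZ// -!meanD//; try exact: cZ.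
apply/andP; split; apply/eqP; congr mean; apply/funext => t; case: (g t) => u v /=; ring.
Qed.

Lemma cmean_cst z : cmean (fun=> z) = z.
Proof. by case: z => a b; rewrite /cmean !mean_cst. Qed.

Lemma ccontR_sum K (c : nat -> R[i]) (g : nat -> R -> R[i]) :
  (forall k, ccontR (g k)) -> ccontR (fun y => \sum_(k < K) c k * g k y).
Proof.
move=> cg; elim: K => [|K IH].
  rewrite (_ : (fun _ => _) = fun=> 0); first exact: ccontR_cst.
  by apply/funext => y; rewrite big_ord0.
under eq_fun do rewrite big_ord_recr/=.
by apply: ccontRD => //; exact: ccontRZ.
Qed.

Lemma cmean_sum K (c : nat -> R[i]) (g : nat -> R -> R[i]) :
  (forall k, ccontR (g k)) ->
  cmean (fun y => \sum_(k < K) c k * g k y) = \sum_(k < K) c k * cmean (g k).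
Proof.
move=> cg; elim: K => [|K IH].
  rewrite big_ord0 -[RHS]cmean_cst; congr cmean.
  by apply/funext => y; rewrite big_ord0.
rewrite big_ord_recr/= -IH -cmeanZ// -cmeanD//.
- by congr cmean; apply/funext => y; rewrite big_ord_recr.
- exact: ccontR_sum.
- exact: ccontRZ.
Qed.

(** Real and imaginary parts are bounded separately. The resulting factor [2] persists in all
    coefficient bounds and is harmless. *)
Lemma cmean_le (g : R -> R[i]) M : ccontR g -> (forall y, normc (g y) <= M) ->
  normc (cmean g) <= 2 * M.
Proof.
move=> [g1 g2] gM; rewrite (le_trans (normc_le_ReIm _ _))//.
have := @mean_norm_le R _ M g1 (fun y => le_trans (Re_le_normc _) (gM y)).
have := @mean_norm_le R _ M g2 (fun y => le_trans (Im_le_normc _) (gM y)).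
lra.
Qed.

Lemma ccontR_circle f x : (forall y, ccont f (polar x y)) -> ccontR (fun y => f (polar x y)).
Proof.
move=> cf; split=> y; apply: continuous_eps => e e0;
  have [d d0 H] := cf y e e0; have [d' d'0 H'] := polar_cont x y d0;
  exists d' => // t ty; have := H' x t; rewrite subrr normr0 => /(_ d'0 ty)[_ /H];
  apply: le_trans.
- by have := Re_le_normc (f (polar x t) - f (polar x y));
     case: (f (polar x t)) (f (polar x y)) => [? ?] [].
- by have := Im_le_normc (f (polar x t) - f (polar x y));
     case: (f (polar x t)) (f (polar x y)) => [? ?] [].
Qed.

(** With [f (exp (x + i y)) = u + i v], the forms [v dx + u dy] and [u dx - v dy] are closed by the
    Cauchy-Riemann equations, and [mean_invariant] applies to each. *)
Lemma cmean_circle f z : (forall w, w != 0 -> ccont f w) ->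
  (forall w, w != 0 -> w != z -> cdiff f w) ->
  forall x1 x2, cmean (fun y => f (polar x1 y)) = cmean (fun y => f (polar x2 y)).
Proof.
move=> cf df.
have [p0 [q0 z0]] : exists p q, z != 0 -> z = polar p q.
  have [->|z0] := eqVneq z 0; first by exists 0, 0 => /eqP.
  by have [p [q ->]] := polar_exists z0; exists p, q.
pose u x y := Re (f (polar x y)); pose v x y := Im (f (polar x y)).
have uper x y : u x (y + pi *+ 2) = u x y by rewrite /u polar2pi.
have vper x y : v x (y + pi *+ 2) = v x y by rewrite /v polar2pi.
have ReB a b : Re (a - b) = Re a - Re b :> R by case: a b => [? ?] [].
have ImB a b : Im (a - b) = Im a - Im b :> R by case: a b => [? ?] [].
have cuv p q e : 0 < e -> exists2 d : R, 0 < d &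
     forall x y, `|x - p| < d -> `|y - q| < d ->
     `|u x y - u p q| <= e /\ `|v x y - v p q| <= e.
  move=> e0; have [d d0 H] := cf _ (polar_neq0 p q) e e0.
  have [d' d'0 H'] := polar_cont p q d0.
  exists d' => // x y xp yq; have [_ /H h] := H' _ _ xp yq.
  by rewrite /u /v -ReB -ImB; split; apply: le_trans h; rewrite ?Re_le_normc ?Im_le_normc.
(* The strip of height [2 pi] is centred at [q0], so that a nonzero [z] has only the logarithm
   [(p0, q0)] in it, boundary lines included. *)
have duv p q : q0 - pi <= q <= q0 - pi + pi *+ 2 -> (p, q) <> (p0, q0) ->
    exists a b : R, forall e, 0 < e -> exists2 d : R, 0 < d &
    forall x y, `|x - p| < d -> `|y - q| < d ->
    `|u x y - (u p q + a * (x - p) + (- b) * (y - q))| <= e * (`|x - p| + `|y - q|) /\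
    `|v x y - (v p q + b * (x - p) + a * (y - q))| <= e * (`|x - p| + `|y - q|).
  move=> qq pq; have [|[a b] H] := @cdiff_polar f p q.
    apply: df (polar_neq0 _ _) _; apply/eqP => E; apply: pq.
    apply: polar_inj; first by rewrite ler_norml; lra.
    by rewrite E; apply: z0; rewrite -E polar_neq0.
  exists a, b => e e0; have [d d0 Hd] := H e e0; exists d => // x y xp yq.
  have h := Hd _ _ xp yq; split; apply: le_trans h.
  - apply: le_trans (Re_le_normc _); rewrite !ReB /u/=.
    by rewrite le_eqVlt; apply/orP; left; apply/eqP; congr `| _ |; ring.
  - apply: le_trans (Im_le_normc _); rewrite !ImB /v/=.
    by rewrite le_eqVlt; apply/orP; left; apply/eqP; congr `| _ |; ring.
have cu x : continuous (v x).
  move=> y; apply: continuous_eps => e e0; have [d d0 H] := cuv x y e e0.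
  by exists d => // t ty; have := H x t; rewrite subrr normr0 => /(_ d0 ty)[].
move=> x1 x2; rewrite /cmean; congr (_ +i* _).
- apply: (@mean_invariant v u p0 q0 (q0 - pi)) => //.
    move=> p q e e0; have [d d0 H] := cuv p q e e0; exists d => // x y xp yq.
    by have [] := H x y xp yq.
  move=> p q qq pq; have [a [b H]] := duv p q qq pq.
  exists b, a, (- b) => e e0; have [d d0 Hd] := H e e0; exists d => // x y xp yq.
  by have [] := Hd x y xp yq.
- have := @mean_invariant u (fun x y => -1 * v x y) p0 q0 (q0 - pi).
  move=> /(_ _ _ _ _ x1 x2)/wrap[||||].
  + move=> p q e e0; have [d d0 H] := cuv p q e e0; exists d => // x y xp yq.
    by rewrite -mulrBr normrM normrN1 mul1r; exact: H.
  + exact: uper.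
  + by move=> x y; rewrite vper.
  + move=> p q qq pq; have [a [b H]] := duv p q qq pq.
    exists a, (- b), (- a) => e e0; have [d d0 Hd] := H e e0; exists d => // x y xp yq.
    have [h1 h2] := Hd x y xp yq; split => //; rewrite -normrN; apply: le_trans h2.
    by rewrite le_eqVlt; apply/orP; left; apply/eqP; congr `| _ |; ring.
  by rewrite !meanZ// => /mulrI; apply; rewrite unitrN1.
Qed.

End circle_mean.

(** * Taylor expansion of entire functions *)

Section taylor.
Variable R : realType.
Implicit Types (x y e M r : R) (z w D : R[i]) (f : R[i] -> R[i]).

Definition taylor_coef f k : R[i] :=
  cmean (fun y => f (polar 0 y) / polar 0 y ^+ k).

Lemma entire_expn k : entire (fun z : R[i] => z ^+ k).
Proof.
elim: k => [|k IH] w.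
  rewrite (_ : (fun z : R[i] => _) = fun=> 1); first exact: derivable_cst.
  by apply/funext => z; rewrite expr0.
rewrite (_ : (fun z : R[i] => _) = (fun z : R[i] => z * z ^+ k)); last first.
  by apply/funext => z; rewrite exprS.
apply: (@derivableM _ _ (id : R[i]^o -> R[i]^o) (fun z : R[i]^o => z ^+ k)).
  exact: derivable_id.
exact: IH.
Qed.

Lemma cdiff_div_exp f k w : entire f -> w != 0 -> cdiff (fun z => f z / z ^+ k) w.
Proof.
move=> ef w0; apply: derivable_cdiff.
apply: (@derivableM _ _ (f : R[i]^o -> R[i]^o) (fun z : R[i]^o => (z ^+ k)^-1)).
  exact: ef.
apply: derivableV; first by rewrite expf_neq0.
exact: entire_expn.
Qed.

Lemma ccontR_div_exp f k x : entire f ->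
  ccontR (fun y => f (polar x y) / polar x y ^+ k).
Proof.
move=> ef; apply: (@ccontR_circle _ (fun z => f z / z ^+ k)) => y.
by apply: cdiff_ccont; apply: cdiff_div_exp => //; exact: polar_neq0.
Qed.

Lemma taylor_coefE f k x : entire f ->
  taylor_coef f k = cmean (fun y => f (polar x y) / polar x y ^+ k).
Proof.
move=> ef; apply: (@cmean_circle _ (fun z => f z / z ^+ k) 0) => w w0 => [|_].
  by apply: cdiff_ccont; exact: cdiff_div_exp.
exact: cdiff_div_exp.
Qed.

Lemma taylor_coef_le f k x M : entire f ->
  (forall z, normc z = expR x -> normc (f z) <= M) ->
  normc (taylor_coef f k) <= 2 * M * expR (- (x *+ k)).
Proof.
move=> ef fM; rewrite (taylor_coefE k x ef) -mulrA; apply: cmean_le.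
  exact: ccontR_div_exp.
move=> y; rewrite normcM normcV normcX normc_polar -expRM_natl expRN mulr_natl.
by rewrite ler_wpM2r ?invr_ge0 ?expR_ge0// fM// normc_polar.
Qed.

Lemma entire_cst z : entire (fun=> z).
Proof. by move=> w; exact: derivable_cst. Qed.

Lemma taylor_coef_expn j k : taylor_coef (fun z => z ^+ j) k = (j == k)%:R.
Proof.
have ej := @entire_expn j.
have [<-|jk] := eqVneq j k.
  rewrite /taylor_coef -[RHS]cmean_cst; congr cmean; apply/funext => y.
  by rewrite divff// expf_neq0// polar_neq0.
apply: eq0_normc; apply/eqP; rewrite eq_le normc_ge0 andbT.
apply/ler_addgt0Pr => e e0; rewrite add0r.
have h x : normc (taylor_coef (fun z => z ^+ j) k) <= 2 * expR (x * (j%:R - k%:R)).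
  have := @taylor_coef_le (fun z => z ^+ j) k x (expR (x *+ j)) ej.
  move=> /(_ _)/wrap[|]; first by move=> z zx; rewrite normcX zx -expRM_natl mulr_natl.
  by rewrite -mulrA -expRD mulrBr !mulr_natr.
have jk0 : j%:R - k%:R != 0 :> R by rewrite subr_eq0 eqr_nat.
(* The bound [h] holds on every circle; on this one it equals [e]. *)
apply: (le_trans (h (ln (e / 2) / (j%:R - k%:R)))).
by rewrite divfK// lnK ?posrE ?divr_gt0// mulrC divfK.
Qed.

Lemma cdiff_near f g z w : (forall v, v != z -> f v = g v) -> w != z -> cdiff f w -> cdiff g w.
Proof.
move=> fg wz [D H]; exists D => e /H[d d0 Hd].
exists (Num.min d (normc (w - z))).
  by rewrite lt_min d0 normc_gt0 subr_eq0.
move=> v; rewrite lt_min => /andP[/Hd + vz]; rewrite -!fg//.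
by apply: contraTneq vz => ->; rewrite normcB ltxx.
Qed.

Lemma derivable_diffquot f z w : entire f -> w != z ->
  derivable ((fun w => w * ((f w - f z) / (w - z))) : R[i]^o -> R[i]^o) w 1.
Proof.
move=> ef wz.
have dz : derivable ((fun w => w - z) : R[i]^o -> R[i]^o) w 1.
  by apply: (@derivableB _ R[i]^o R[i]^o id (fun=> z)); [exact: derivable_id|exact: derivable_cst].
have df : derivable ((fun w => f w - f z) : R[i]^o -> R[i]^o) w 1.
  by apply: (@derivableB _ R[i]^o R[i]^o f (fun=> f z)); [exact: ef|exact: derivable_cst].
have di : derivable ((fun w => (w - z)^-1) : R[i]^o -> R[i]^o) w 1.
  by apply: derivableV dz; rewrite subr_eq0.
apply: (@derivableM _ _ (id : R[i]^o -> R[i]) (fun w : R[i]^o => (f w - f z) / (w - z))).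
  exact: derivable_id.
apply: (@derivableM _ _ (fun w : R[i]^o => f w - f z) (fun w : R[i]^o => (w - z)^-1)).
  exact: df.
exact: di.
Qed.

(** Cauchy's formula in disguise. Completed by [z f'(z)] at [z], the function [g] is continuous
    everywhere, so its means over all circles about [0] agree. On shrinking circles they tend to the
    value at [0], which the factor [w] makes zero. *)
Lemma diffquot_mean f z (g := fun w => w * ((f w - f z) / (w - z))) x :
  entire f -> normc z < expR x -> cmean (fun y => g (polar x y)) = 0.
Proof.
move=> ef zx.
have [D HD] := derivable_cdiff (ef z).
pose h w := if w == z then z * D else g w.
have gh w : w != z -> g w = h w by rewrite /h; case: eqP.
have dg w : w != z -> cdiff g w.
  by move=> wz; apply: derivable_cdiff; exact: derivable_diffquot.
have dh w : w != z -> cdiff h w by move=> wz; exact: (@cdiff_near g h z w gh wz (dg w wz)).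
have ch w : ccont h w.
  have [->|/dh/cdiff_ccont//] := eqVneq w z.
  move=> e e0.
  have k0 : 0 < 2 * (normc z + 1) by rewrite mulr_gt0// ltr_wpDl ?normc_ge0.
  have k1 : 0 < 2 * (normc D + 1) by rewrite mulr_gt0// ltr_wpDl ?normc_ge0.
  have [d d0 Hd] := HD _ (divr_gt0 e0 k0).
  exists (Num.min (Num.min d 1) (e / (2 * (normc D + 1)))).
    by rewrite !lt_min d0 ltr01 divr_gt0.
  move=> v; rewrite !lt_min => /andP[/andP[/Hd h1 h2] h3].
  rewrite /h eqxx; case: eqP => [_|/eqP vz]; first by rewrite subrr normc0 ltW.
  have vz0 : v - z != 0 by rewrite subr_eq0.
  have -> : g v - z * D = v * ((f v - f z - D * (v - z)) / (v - z)) + D * (v - z).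
    by rewrite /g; field.
  have nv : normc v <= normc z + 1.
    by rewrite -(subrK z v) (le_trans (normcD_le _ _))//; lra.
  have n0 : 0 < normc (v - z) by rewrite normc_gt0.
  have l1 : normc (v * ((f v - f z - D * (v - z)) / (v - z))) <= e / 2.
    have -> : e / 2 = (normc z + 1) * (e / (2 * (normc z + 1))).
      by have := normc_ge0 z => zz; field; lra.
    by rewrite normcM ler_pM ?normc_ge0// normcM normcV ler_pdivrMr.
  have l2 : normc (D * (v - z)) <= e / 2.
    have -> : e / 2 = (normc D + 1) * (e / (2 * (normc D + 1))).
      by have := normc_ge0 D => zz; field; lra.
    by rewrite normcM ler_pM ?normc_ge0// ?lerDl// ltW.
  by rewrite (le_trans (normcD_le _ _))//; lra.
have inv := @cmean_circle _ h z (fun w _ => ch w) (fun w _ => @dh w).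
have -> : cmean (fun y => g (polar x y)) = cmean (fun y => h (polar x y)).
  congr cmean; apply/funext => y; apply: gh.
  by apply: contraTneq zx => <-; rewrite normc_polar ltxx.
have h0 : h 0 = 0 by rewrite /h /g mul0r; case: eqP => // <-; rewrite mul0r.
apply: eq0_normc; apply/eqP; rewrite eq_le normc_ge0 andbT.
apply/ler_addgt0Pr => e e0; rewrite add0r.
have [d d0 Hd] := ch 0 (e / 2) (divr_gt0 e0 (@ltr0Sn _ 1)).
rewrite (inv _ (ln (d / 2))) (le_trans (@cmean_le _ _ (e / 2) _ _))//; last by lra.
  exact: ccontR_circle.
move=> y; rewrite -[h _]subr0 -h0; apply: Hd.
by rewrite subr0 normc_polar lnK ?posrE; lra.
Qed.

(** Multiply [w / (w - z) = sum_(k < n) z^k / w^k + (z / w)^n w / (w - z)] by [f w - f z] and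
    average over the circle. The left side has mean zero by [diffquot_mean], and [f z / w^k] has
    nonzero mean only for [k = 0], so the Taylor remainder is the mean of the last term. *)
Lemma taylor_remainder f z x M K : entire f -> normc z < expR x ->
  normc (f z) <= M -> (forall w, normc w = expR x -> normc (f w) <= M) ->
  normc (f z - \sum_(k < K.+1) taylor_coef f k * z ^+ k) <=
  2 * ((normc z / expR x) ^+ K.+1 * (expR x * (2 * M / (expR x - normc z)))).
Proof.
move=> ef zx zM fM.
pose g w := w * ((f w - f z) / (w - z)).
have e1 := @entire_cst 1.
have x0 := expR_gt0 x.
have wz w : normc w = expR x -> (w != z) * (w != 0).
  move=> wx; split; first by apply: contraTneq zx => <-; rewrite wx ltxx.
  by rewrite -normc_gt0 wx.
have geo n w : normc w = expR x ->
    g w = \sum_(k < n) z ^+ k * (f w / w ^+ k + (- f z) * (1 / w ^+ k)) + z ^+ n * (g w / w ^+ n).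
  move=> /wz[wz1 w0]; rewrite /g.
  have w1 : w - z != 0 by rewrite subr_eq0.
  elim: n => [|n IH]; first by rewrite big_ord0 add0r !expr0 mul1r divr1.
  rewrite [LHS]IH.
  rewrite big_ord_recr/= -addrA; congr (_ + _).
  rewrite !exprS; move: (w ^+ n) (expf_neq0 n w0) (z ^+ n) => W W0 Z.
  by field; rewrite W0 w0.
pose c k := taylor_coef f k - f z * taylor_coef (fun=> 1) k.
have cont1 k : ccontR (fun y => f (polar x y) / polar x y ^+ k + - f z * (1 / polar x y ^+ k)).
  apply: ccontRD; first exact: ccontR_div_exp.
  apply: (@ccontRZ _ (fun y => 1 / polar x y ^+ k)).
  exact: (@ccontR_div_exp (fun=> 1)).
have contg : ccontR (fun y => g (polar x y) / polar x y ^+ K.+1).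
  apply: (@ccontR_circle _ (fun w => g w / w ^+ K.+1)) => y.
  apply: cdiff_ccont; apply: derivable_cdiff.
  have [pz p0] := wz _ (normc_polar x y).
  apply: (@derivableM _ _ (g : R[i]^o -> R[i]^o) (fun z : R[i]^o => (z ^+ K.+1)^-1)).
    exact: derivable_diffquot.
  apply: derivableV; first by rewrite expf_neq0.
  exact: entire_expn.
have := diffquot_mean ef zx; rewrite -/g.
have -> : (fun y => g (polar x y)) = (fun y =>
    \sum_(k < K.+1) z ^+ k * (f (polar x y) / polar x y ^+ k + (- f z) * (1 / polar x y ^+ k)) +
    z ^+ K.+1 * (g (polar x y) / polar x y ^+ K.+1)).
  by apply/funext => y; rewrite {1}(geo K.+1) ?normc_polar.
rewrite cmeanD; last 2 first.
- exact: (@ccontR_sum _ K.+1 (fun k => z ^+ k)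
    (fun k y => f (polar x y) / polar x y ^+ k + - f z * (1 / polar x y ^+ k))).
- exact: ccontRZ.
rewrite (@cmean_sum _ K.+1 (fun k => z ^+ k)
    (fun k y => f (polar x y) / polar x y ^+ k + - f z * (1 / polar x y ^+ k)))//.
have cE k : cmean (fun y => f (polar x y) / polar x y ^+ k + - f z * (1 / polar x y ^+ k)) =
    taylor_coef f k - f z * (0%N == k)%:R.
  rewrite cmeanD; last 2 first.
  - exact: ccontR_div_exp.
  - by apply: (@ccontRZ _ (fun y => 1 / polar x y ^+ k)); exact: (@ccontR_div_exp (fun=> 1)).
  rewrite (@cmeanZ _ (fun y => 1 / polar x y ^+ k)); last exact: (@ccontR_div_exp (fun=> 1)).
  by rewrite -taylor_coefE// -(@taylor_coefE (fun=> 1))// -(taylor_coef_expn 0 k) mulNr.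
under eq_bigr do rewrite cE mulrBr.
rewrite sumrB.
have -> : \sum_(i < K.+1) z ^+ i * (f z * (0%N == i)%:R) = f z.
  rewrite big_ord_recl/= big1 ?addr0 ?expr0 ?mul1r ?mulr1// => i _.
  by rewrite !mulr0.
under eq_bigr do rewrite mulrC.
move=> E.
have -> : f z - \sum_(k < K.+1) taylor_coef f k * z ^+ k =
    cmean (fun y => z ^+ K.+1 * (g (polar x y) / polar x y ^+ K.+1)).
  apply/eqP; rewrite -subr_eq0 -oppr_eq0; apply/eqP; rewrite -[RHS]E; ring.
apply: cmean_le; first exact: ccontRZ.
move=> y; have ny := normc_polar x y; have [yz y0] := wz _ ny.
have -> : normc (z ^+ K.+1 * (g (polar x y) / polar x y ^+ K.+1)) =
    (normc z / expR x) ^+ K.+1 * normc (g (polar x y)).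
  by rewrite normcM normcX normcM normcV normcX ny expr_div_n mulrA mulrAC.
rewrite ler_wpM2l ?exprn_ge0 ?divr_ge0 ?normc_ge0 ?expR_ge0//.
rewrite /g normcM ny ler_wpM2l ?expR_ge0// normcM normcV ler_pM ?normc_ge0 ?invr_ge0 ?normc_ge0//.
  by rewrite (le_trans (normcB_le _ _))// mulr2n mulrDl mul1r lerD// fM.
rewrite lef_pV2 ?posrE ?normc_gt0 ?subr_eq0 ?subr_gt0//.
by rewrite -{1}ny normc_lerB.
Qed.

Lemma taylor_cvg f z : entire f -> (forall x, exists M, forall w, normc w <= expR x -> normc (f w) <= M) ->
  forall e, 0 < e -> exists K0, forall K, (K0 <= K)%N ->
  normc (f z - \sum_(k < K) taylor_coef f k * z ^+ k) <= e.
Proof.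
move=> ef fb e e0.
(* On this circle the ratio [|z| / expR x] is at most [1 / 2]. *)
pose x := ln (2 * (normc z + 1)).
have nz := normc_ge0 z.
have xE : expR x = 2 * (normc z + 1) by rewrite lnK// posrE; lra.
have [M HM] := fb x.
have M0 : 0 <= M by apply: le_trans (normc_ge0 _) (HM 0 _); rewrite normc0 expR_ge0.
pose C := 2 * (expR x * (2 * M / (expR x - normc z))).
have C0 : 0 <= C.
  rewrite mulr_ge0// mulr_ge0 ?expR_ge0// divr_ge0 ?mulr_ge0//; lra.
exists (Num.bound (C / e)).+1 => -[//|K] K0.
apply: le_trans (@taylor_remainder f z x M K _ _ _ _) _ => //.
- by lra.
- by apply: HM; lra.
- by move=> w wx; apply: HM; rewrite wx.
rewrite mulrCA -/C.
have q2 : normc z / expR x <= 2^-1 by rewrite xE ler_pdivrMr; lra.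
apply: (@le_trans _ _ (2^-1 ^+ K.+1 * C)).
  by rewrite ler_wpM2r// lerXn2r ?nnegrE ?divr_ge0 ?expR_ge0.
rewrite exprVn mulrC ler_pdivrMr ?exprn_gt0// mulrC -ler_pdivrMr//.
apply: le_trans (ltW (archi_boundP _)) _; first by rewrite divr_ge0// ltW.
rewrite -natrX ler_nat; apply: (@leq_trans (2 ^ Num.bound (C / e))%N).
  exact/ltnW/ltn_expl.
by rewrite leq_exp2l// ltnW.
Qed.

End taylor.

(** * Gaussian sums *)

Section gauss.
Variable R : realType.
Implicit Types (x t a theta B : R) (z : R[i]) (f : R[i] -> R[i]).
Variable alpha : R.
Hypothesis alpha_gt0 : 0 < alpha.

Lemma logp_ge0 t : 0 <= logp t.
Proof. by rewrite /logp le_max lexx orbT. Qed.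

Lemma le_expR_logp t : t <= expR (logp t).
Proof.
have [t0|t0] := leP t 0; first exact: le_trans t0 (expR_ge0 _).
by rewrite -[leLHS](lnK (x := t)) ?posrE// ler_expR /logp le_max lexx.
Qed.

Lemma logp_le t x : t <= expR x -> logp t <= Num.max x 0.
Proof.
move=> tx; have [t0|t0] := leP t 0.
  by rewrite /logp ln0// maxxx le_max lexx orbT.
rewrite /logp ge_max !le_max lexx orbT andbT.
by rewrite -(expRK x) ler_ln ?posrE ?expR_gt0// tx.
Qed.

Lemma logp_expR x : 0 <= x -> logp (expR x) = x.
Proof. by move=> x0; rewrite /logp expRK max_l. Qed.

Lemma logp_ln t : 1 <= t -> logp t = ln t.
Proof. by move=> t1; rewrite /logp max_l// ln_ge0. Qed.

(** The parabola lies below its tangents: this is [(|x| - 2 alpha a)^2 >= 0]. It trades Gaussian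
    decay for exponential decay at any rate [a]. *)
Lemma gauss_le a x :
  expR (- x ^+ 2 / (4 * alpha)) <= expR (alpha * a ^+ 2) * expR (- a * `|x|).
Proof.
rewrite -expRD ler_expR ler_pdivrMr ?mulr_gt0//.
have := sqr_ge0 (`|x| - 2 * alpha * a); rewrite sqrrB real_normK ?num_real//.
have := alpha_gt0; nra.
Qed.

Lemma geometric_two_sided K m :
  \sum_(k < K) (2^-1 : R) ^+ (maxn k m - minn k m) <= 3.
Proof.
have h N : \sum_(k < N) (2^-1 : R) ^+ k <= 2 - 2^-1 ^+ N * 2.
  elim: N => [|N IH]; first by rewrite big_ord0 expr0 mul1r subrr.
  by rewrite big_ord_recr/= exprSr; lra.
have p N : 0 <= (2^-1 : R) ^+ N by rewrite exprn_ge0// invr_ge0.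
have low N : (N <= m)%N -> \sum_(k < N) (2^-1 : R) ^+ (maxn k m - minn k m) <= 2^-1 ^+ (m - N).
  elim: N => [|N IH] Nm; first by rewrite big_ord0.
  rewrite big_ord_recr/= (maxn_idPr _) ?(minn_idPl _) 1?ltnW//.
  have := IH (ltnW Nm); rewrite -(subnSK Nm) exprS.
  lra.
have [Km|mK] := leqP K m.
  by apply: le_trans (low _ Km) _; rewrite (le_trans (exprn_ile1 _ _ _))//; lra.
rewrite -(subnKC (ltnW mK)) big_split_ord/=/=.
apply: (@le_trans _ _ (1 + 2)); last by lra.
apply: lerD; first by apply: le_trans (low _ (leqnn m)) _; rewrite subnn expr0.
rewrite (eq_bigr (fun k : 'I_(K - m) => 2^-1 ^+ k)) => [|i _].
  by apply: le_trans (h _) _; have := p (K - m)%N; lra.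
by rewrite (maxn_idPl _) ?(minn_idPr _) ?leq_addr// addKn.
Qed.

(** The bound is uniform in [m] and in the shift [theta], which will be a fractional part. The rate
    [a + 1] in [gauss_le] beats the growth rate [a] and leaves [expR (- |k - m|)], dominated by
    powers of [1 / 2]. *)
Lemma gauss_sum a : 0 <= a -> exists2 G, 0 < G & forall K m theta, 0 <= theta <= 1 ->
  \sum_(k < K) expR (- (k%:R - m%:R - theta) ^+ 2 / (4 * alpha) + a * `|k%:R - m%:R|) <= G.
Proof.
move=> a0; pose b := a + 1.
exists (expR (alpha * b ^+ 2) * expR b * 3); first by rewrite !mulr_gt0// expR_gt0.
move=> K m theta /andP[th0 th1].
apply: le_trans (ler_wpM2l _ (geometric_two_sided K m)); last first.
  by rewrite mulr_ge0 ?expR_ge0.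
rewrite mulr_sumr; apply: ler_sum => k _; rewrite expRD.
have : (maxn k m - minn k m)%:R = `|k%:R - m%:R| :> R.
  have [km|mk] := leqP k m; first by rewrite natrB// distrC ger0_norm// subr_ge0 ler_nat.
  by rewrite natrB 1?ltnW// ger0_norm// subr_ge0 ler_nat ltnW.
set N := (maxn k m - minn k m)%N => NE; rewrite -NE.
have x1 : N%:R - 1 <= `|k%:R - m%:R - theta|.
  rewrite NE; have := lerB_normD (k%:R - m%:R) (- theta); rewrite normrN.
  by rewrite (ger0_norm th0); lra.
apply: (@le_trans _ _ (expR (alpha * b ^+ 2) * expR (- b * (N%:R - 1)) * expR (a * N%:R))).
  rewrite ler_wpM2r ?expR_ge0// (le_trans (gauss_le b _))//.
  rewrite ler_wpM2l ?expR_ge0// ler_expR !mulNr lerN2 ler_wpM2l// /b; lra.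
rewrite -!mulrA ler_wpM2l ?expR_ge0// -expRD.
have -> : - b * (N%:R - 1) + a * N%:R = b + N%:R * (- 1) by rewrite /b; ring.
rewrite expRD expRM_natl ler_wpM2l ?expR_ge0// lerXn2r ?nnegrE ?expR_ge0 ?invr_ge0//.
rewrite expRN lef_pV2 ?posrE ?expR_gt0//.
by have := expR_ge1Dx (1 : R); lra.
Qed.

End gauss.

(** * Lagrange interpolation *)

Section lagrange.
Variable F : fieldType.
Implicit Types (s : seq F) (l m z : F).

Definition lagrange_basis s l z : F := \prod_(m <- s | m != l) ((z - m) / (l - m)).

(** The difference of the two sides is a polynomial of degree less than [size s] vanishing at the
    [size s] nodes. *)
Lemma lagrange_monomial s k z : uniq s -> (k < size s)%N ->
  z ^+ k = \sum_(l <- s) lagrange_basis s l z * l ^+ k.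
Proof.
move=> us ks.
pose c l : F := l ^+ k / \prod_(m <- s | m != l) (l - m).
pose p : {poly F} := 'X^k - \sum_(l <- s) c l *: \prod_(m <- s | m != l) ('X - m%:P).
have sp : (size p <= size s)%N.
  rewrite (leq_trans (size_polyD _ _))// geq_max size_polyXn ks/= size_polyN.
  rewrite (leq_trans (size_sum _ _ _))//; apply/bigmax_leqP_seq => l ls _.
  rewrite (leq_trans (size_scale_leq _ _))// -big_filter size_prod_XsubC.
  by rewrite size_filter -[leqRHS](count_predC (pred1 l)) -add1n leq_add2r count_uniq_mem// ls.
have hc l : l \in s -> \prod_(m <- s | m != l) (l - m) != 0.
  by move=> ls; rewrite prodf_seq_neq0; apply/allP => m ms; apply/implyP; rewrite subr_eq0 eq_sym.
have pE x : p.[x] = x ^+ k - \sum_(l <- s) c l * \prod_(m <- s | m != l) (x - m).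
  rewrite hornerD hornerN hornerXn horner_sum; congr (_ - _).
  apply: eq_bigr => l _; rewrite hornerZ horner_prod; congr (_ * _).
  by apply: eq_bigr => m _; rewrite !hornerE.
have p0 : p = 0.
  apply: (@roots_geq_poly_eq0 _ _ s) => //; apply/allP => x xs.
  rewrite /root pE (bigD1_seq x)//= /c divfK ?hc// big1_seq ?addr0 ?subrr//.
  move=> l /andP[lx ls]; apply/eqP; rewrite mulf_eq0; apply/orP; right.
  by rewrite prodf_seq_eq0; apply/hasP; exists x => //=; rewrite eq_sym lx subrr eqxx.
have := pE z; rewrite p0 horner0 => /esym/eqP; rewrite subr_eq0 => /eqP ->.
apply: eq_bigr => l _; rewrite /c /lagrange_basis prodf_div; ring.
Qed.

End lagrange.

Section interpolation.
Variable R : realType.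
Variables (c t0 : R) (s : seq R[i]) (z0 : R[i]) (m1 : nat).
Implicit Types (l m : R[i]) (k i : nat).
Hypothesis c_gt0 : 0 < c.
Hypothesis c_le1 : c <= 1.
Hypothesis s_uniq : uniq s.
Hypothesis s_gt0 : forall l, l \in s -> 0 < normc l.
Hypothesis s_sep : forall l m, l \in s -> m \in s -> l != m ->
  c * Num.max (normc l) (normc m) <= normc (l - m).
Hypothesis z0_le : normc z0 <= expR t0.

Let tau l : R := ln (normc l).
Let n := size s.
(** The factor [(z0 / l)^m1] shifts the window of degrees reproduced exactly from [[0, n)] to
    [[m1, m1 + n)]. *)
Let W l := (z0 / l) ^+ m1 * lagrange_basis s l z0.
Let Q := \sum_(m <- s) Num.max t0 (tau m).

Lemma ge1_2c : 1 <= 2 / c.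
Proof. by have := c_le1; rewrite ler_pdivlMr//; lra. Qed.

(** Each factor is at most [2 max (expR t0, |m|)] over [c max (|l|, |m|)]. The factor missing at
    [m = l] is replaced by one that is at least [1], so both sums run over all of [s]. *)
Lemma lagrange_basis_le l : l \in s ->
  normc (lagrange_basis s l z0) <=
  (2 / c) ^+ n * expR (Q - \sum_(m <- s) Num.max (tau l) (tau m)).
Proof.
move=> ls; rewrite /lagrange_basis normc_prod.
have -> : (2 / c) ^+ n * expR (Q - \sum_(m <- s) Num.max (tau l) (tau m)) =
    \prod_(m <- s) (2 / c * expR (Num.max t0 (tau m) - Num.max (tau l) (tau m))).
  by rewrite big_split/= big_const_seq count_predT -Monoid.iteropE -expR_sum sumrB.
rewrite big_mkcond/= !big_seq; apply: ler_prod => m ms.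
have m0 := s_gt0 ms.
case: ifPn => [ml|/negPn/eqP ->]; last first.
  rewrite ler01/= maxxx mulr_ege1 ?ge1_2c// -expR0 ler_expR subr_ge0 le_max lexx orbT//.
rewrite normc_ge0/= normcM normcV.
have h1 : normc (z0 - m) <= 2 * expR (Num.max t0 (tau m)).
  rewrite (le_trans (normcB_le _ _))// mulr2n mulrDl mul1r lerD//.
    by rewrite (le_trans z0_le)// ler_expR le_max lexx.
  by rewrite -[leLHS](@lnK _ (normc m)) ?posrE// ler_expR le_max lexx orbT.
have h2 : c * expR (Num.max (tau l) (tau m)) <= normc (l - m).
  apply: le_trans (s_sep ls ms _); last by rewrite eq_sym.
  rewrite ler_pM2l// le_max /tau.
  by case: (leP (ln (normc l)) (ln (normc m))) => _;
    rewrite lnK ?posrE ?lexx ?orbT// s_gt0.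
have n0 : 0 < normc (l - m) by apply: lt_le_trans h2; rewrite mulr_gt0 ?expR_gt0.
rewrite expRB ler_pdivrMr// (le_trans h1)//.
have -> : 2 / c * (expR (Num.max t0 (tau m)) / expR (Num.max (tau l) (tau m))) * normc (l - m)
  = 2 * expR (Num.max t0 (tau m)) * (normc (l - m) / (c * expR (Num.max (tau l) (tau m)))).
  by field; rewrite !gt_eqF ?expR_gt0.
by rewrite ler_peMr ?mulr_ge0 ?expR_ge0// ler_pdivlMr ?mul1r ?mulr_gt0 ?expR_gt0.
Qed.

Lemma normc_expR_tau l k : l \in s -> normc l ^+ k = expR (k%:R * tau l).
Proof. by move=> ls; rewrite expRM_natl /tau lnK// posrE s_gt0. Qed.

Lemma weight_le l : l \in s ->
  normc (W l) <= (2 / c) ^+ n *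
    expR (m1%:R * (t0 - tau l) + Q - \sum_(m <- s) Num.max (tau l) (tau m)).
Proof.
move=> ls; rewrite normcM -addrA expRD mulrCA ler_pM ?normc_ge0 ?lagrange_basis_le//.
rewrite normcX normcM normcV expRM_natl lerXn2r ?nnegrE ?expR_ge0//.
  by rewrite divr_ge0 ?normc_ge0.
by rewrite expRB /tau lnK ?posrE ?s_gt0// ler_wpM2r// invr_ge0 normc_ge0.
Qed.

Lemma monomial_exact k : (m1 <= k < m1 + n)%N ->
  z0 ^+ k - \sum_(l <- s) W l * l ^+ k = 0.
Proof.
move=> /andP[mk kn].
have jn : (k - m1 < n)%N by rewrite ltn_subLR.
rewrite -(subnKC mk); move: (k - m1)%N jn => j jn.
rewrite exprD (lagrange_monomial z0 s_uniq jn).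
rewrite mulr_sumr -sumrB big1_seq// => l /andP[_ ls].
have l0 : l != 0 by rewrite -normc_gt0 s_gt0.
by rewrite /W exprD expr_div_n; field; rewrite expf_neq0.
Qed.

Lemma error_bound k E : k%:R * t0 <= E ->
  (forall l, l \in s -> m1%:R * (t0 - tau l) + Q - \sum_(m <- s) Num.max (tau l) (tau m)
     + k%:R * tau l <= E) ->
  normc (z0 ^+ k - \sum_(l <- s) W l * l ^+ k) <= (1 + n%:R) * (2 / c) ^+ n * expR E.
Proof.
move=> h0 hl; have g1 : 1 <= (2 / c) ^+ n by rewrite exprn_ege1// ge1_2c.
have g0 : 0 <= (2 / c) ^+ n by apply: le_trans g1.
rewrite (le_trans (normcB_le _ _))// -mulrA mulrDl mul1r lerD//.
  rewrite normcX (le_trans (_ : _ <= expR E))//; last first.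
    by rewrite ler_peMl ?expR_ge0.
  apply: (@le_trans _ _ (expR t0 ^+ k)); first by rewrite lerXn2r ?nnegrE ?normc_ge0 ?expR_ge0.
  by rewrite -expRM_natl ler_expR.
rewrite (le_trans (normc_sum _ _ _))//.
have -> : n%:R * ((2 / c) ^+ n * expR E) = \sum_(l <- s) (2 / c) ^+ n * expR E.
  by rewrite big_const_seq count_predT iter_addr_0 mulr_natl.
rewrite !big_seq; apply: ler_sum => l ls.
rewrite normcM normcX normc_expR_tau//.
apply: le_trans (ler_wpM2r (expR_ge0 _) (weight_le ls)) _.
by rewrite -mulrA ler_wpM2l// -expRD ler_expR hl.
Qed.

Lemma sum_max_ge l : n%:R * tau l <= \sum_(m <- s) Num.max (tau l) (tau m).
Proof.
rewrite mulr_natl -[n]count_predT -iter_addr_0 -big_const_seq.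
by apply: ler_sum => m _; rewrite le_max lexx.
Qed.

Lemma sum_max_ge_tau l : \sum_(m <- s) tau m <= \sum_(m <- s) Num.max (tau l) (tau m).
Proof. by apply: ler_sum => m _; rewrite le_max lexx orbT. Qed.

(** Since the sum of maxima is at least [n tau l], the denominators of [W l] absorb [l^(m1 + n)];
    only [l^i] is left, at most [expR (i Tm)]. *)
Lemma top_error i Tm : t0 <= Tm -> (forall l, l \in s -> tau l <= Tm) ->
  normc (z0 ^+ (m1 + n + i) - \sum_(l <- s) W l * l ^+ (m1 + n + i)) <=
  (1 + n%:R) * (2 / c) ^+ n * expR (i%:R * Tm + m1%:R * t0 + Q).
Proof.
move=> t0T sT; apply: error_bound.
  have : n%:R * t0 <= Q.
    rewrite mulr_natl -[n]count_predT -iter_addr_0 -big_const_seq.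
    by apply: ler_sum => m _; rewrite le_max lexx.
  have : i%:R * t0 <= i%:R * Tm by rewrite ler_wpM2l.
  by rewrite !natrD; lra.
move=> l ls; have := sum_max_ge l.
have : i%:R * tau l <= i%:R * Tm by rewrite ler_wpM2l// sT.
by rewrite !natrD; lra.
Qed.

(** For low degrees the sum of maxima is bounded below by the sum of the [tau m], which does not
    involve [l]; what remains is [l^(- i)], at most [expR (- i Tn)]. *)
Lemma bottom_error k i Tn : (k + i)%N = m1 -> Tn <= t0 -> (forall l, l \in s -> Tn <= tau l) ->
  normc (z0 ^+ k - \sum_(l <- s) W l * l ^+ k) <=
  (1 + n%:R) * (2 / c) ^+ n *
  expR (- (i%:R * Tn) + m1%:R * t0 + \sum_(m <- s) (Num.max t0 (tau m) - tau m)).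
Proof.
move=> ki t0T sT; rewrite -ki; apply: error_bound.
  have : 0 <= \sum_(m <- s) (Num.max t0 (tau m) - tau m).
    by apply: sumr_ge0 => m _; rewrite subr_ge0 le_max lexx orbT.
  have : i%:R * Tn <= i%:R * t0 by rewrite ler_wpM2l.
  by rewrite !natrD; lra.
move=> l ls; have := sum_max_ge_tau l; rewrite sumrB -/Q.
have : i%:R * Tn <= i%:R * tau l by rewrite ler_wpM2l// sT.
by rewrite -ki !natrD; lra.
Qed.

(** The weight exponents at [l] and [z0] differ by [alpha (tau l - t0)^2] plus a linear term of
    slope [2 alpha t0]; the power [m1] cancels this slope up to [X]. *)
Lemma node_term X T alpha l : 0 < alpha -> l \in s -> `|2 * alpha * t0 - m1%:R| <= X ->
  (forall m, m \in s -> `|tau m - t0| <= T) ->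
  normc (W l) * expR (alpha * tau l ^+ 2) * expR (- (alpha * t0 ^+ 2)) <=
  (2 / c) ^+ n * expR (X * T + n%:R * T + alpha * T ^+ 2).
Proof.
move=> al0 ls hX hT; have g0 : 0 <= (2 / c) ^+ n by rewrite exprn_ge0// (le_trans ler01 ge1_2c).
rewrite -mulrA -expRD.
apply: le_trans (ler_wpM2r (expR_ge0 _) (weight_le ls)) _.
rewrite -mulrA ler_wpM2l// -expRD ler_expR.
have tl := hT _ ls.
have T0 : 0 <= T by apply: le_trans (normr_ge0 _) tl.
have hQ : Q - \sum_(m <- s) Num.max (tau l) (tau m) <= n%:R * T.
  rewrite -sumrB mulr_natl -[n]count_predT -iter_addr_0 -big_const_seq.
  apply: ler_sum => m _; move: tl; rewrite ler_norml => /andP[h1 h2].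
  by case: (leP t0 (tau m)) => ?; case: (leP (tau l) (tau m)) => ?; lra.
have h3 : (2 * alpha * t0 - m1%:R) * (tau l - t0) <= X * T.
  by rewrite (le_trans (ler_norm _))// normrM ler_pM.
have h4 : alpha * (tau l - t0) ^+ 2 <= alpha * T ^+ 2.
  by rewrite ler_pM2l// -[leLHS]real_normK ?num_real// lerXn2r ?nnegrE.
have : alpha * (tau l - t0) ^+ 2 = alpha * tau l ^+ 2 - 2 * alpha * tau l * t0 + alpha * t0 ^+ 2 by ring.
lra.
Qed.

End interpolation.

Section interpolation_estimate.
Variable R : realType.

(** Here [B] measures the coefficients, [delta] the values at the nodes, and [E] the weighted error
    exponent at the two edges of the exact window. The conditions on [2 alpha Tm] and [2 alpha Tn]
    put the degrees attached to the nodes inside the window, so that going [i] degrees beyond an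
    edge costs a further [exp (- i^2 / (4 alpha))]; [gauss_sum] adds these up. *)
Lemma interpolation_estimate (alpha : R) : 0 < alpha -> exists2 G : R, 0 < G &
  forall (c t0 : R) (s : seq R[i]) (z0 : R[i]) (m1 K : nat) (a : nat -> R[i])
    (B delta Tn Tm X T E : R),
  0 < c -> c <= 1 -> uniq s -> (forall l, l \in s -> 0 < normc l) ->
  (forall l m, l \in s -> m \in s -> l != m ->
     c * Num.max (normc l) (normc m) <= normc (l - m)) ->
  normc z0 <= expR t0 ->
  (forall k, normc (a k) <= B * expR (- k%:R ^+ 2 / (4 * alpha))) ->
  0 <= delta ->
  (forall l, l \in s -> normc (\sum_(k < K) a k * l ^+ k) <=
     delta * expR (alpha * ln (normc l) ^+ 2)) ->
  t0 <= Tm -> (forall l, l \in s -> ln (normc l) <= Tm) ->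
  2 * alpha * Tm <= (m1 + size s)%:R ->
  - (m1 + size s)%:R ^+ 2 / (4 * alpha) + m1%:R * t0 +
    \sum_(m <- s) Num.max t0 (ln (normc m)) - alpha * t0 ^+ 2 <= E ->
  ((0 < m1)%N -> [/\ Tn <= t0, (forall l, l \in s -> Tn <= ln (normc l)),
     m1%:R <= 2 * alpha * Tn &
     - m1%:R ^+ 2 / (4 * alpha) + m1%:R * t0 +
     \sum_(m <- s) (Num.max t0 (ln (normc m)) - ln (normc m)) - alpha * t0 ^+ 2 <= E]) ->
  `|2 * alpha * t0 - m1%:R| <= X ->
  (forall m, m \in s -> `|ln (normc m) - t0| <= T) ->
  normc (\sum_(k < K) a k * z0 ^+ k) * expR (- (alpha * t0 ^+ 2)) <=
  delta * ((size s)%:R * ((2 / c) ^+ size s * expR (X * T + (size s)%:R * T + alpha * T ^+ 2))) +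
  B * (2 * G * ((1 + (size s)%:R) * (2 / c) ^+ size s * expR E)).
Proof.
move=> al0; have [G G0 HG] := gauss_sum al0 (lexx 0).
exists G => // c t0 s z0 m1 K a B delta Tn Tm X T E c0 c1 us s0 ssep z0t aB d0 Pd.
move=> t0m sm mT hE hb hX hT.
have B0 : 0 <= B.
  have := le_trans (normc_ge0 _) (aB 0); rewrite pmulr_lge0// expR_gt0//.
pose W l := (z0 / l) ^+ m1 * lagrange_basis s l z0.
set n := size s; pose C := (1 + n%:R) * (2 / c) ^+ n.
have g1 : 0 <= (2 / c) ^+ n by rewrite exprn_ge0// (le_trans ler01 (ge1_2c c0 c1)).
have C0 : 0 <= C by rewrite mulr_ge0// addr_ge0.
pose err k := z0 ^+ k - \sum_(l <- s) W l * l ^+ k.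
have -> : \sum_(k < K) a k * z0 ^+ k =
    \sum_(l <- s) W l * (\sum_(k < K) a k * l ^+ k) + \sum_(k < K) a k * err k.
  under [in X in _ = X + _]eq_bigr do rewrite mulr_sumr.
  rewrite exchange_big/= -big_split/=; apply: eq_bigr => k _.
  rewrite /err mulrBr mulr_sumr [X in _ = _ + (_ - X)](eq_bigr (fun l => W l * (a k * l ^+ k))).
    by rewrite addrC subrK.
  by move=> l _; rewrite mulrCA.
set D := expR (- (alpha * t0 ^+ 2)); have D0 : 0 <= D by exact: expR_ge0.
apply: le_trans (ler_wpM2r D0 (normcD_le _ _)) _; rewrite mulrDl; apply: lerD.
  apply: le_trans (ler_wpM2r D0 (normc_sum _ _ _)) _.
  rewrite mulr_suml.
  have -> : delta * (n%:R * ((2 / c) ^+ n * expR (X * T + n%:R * T + alpha * T ^+ 2))) =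
     \sum_(l <- s) delta * ((2 / c) ^+ n * expR (X * T + n%:R * T + alpha * T ^+ 2)).
    by rewrite big_const_seq count_predT iter_addr_0 -mulr_natl; ring.
  rewrite !big_seq; apply: ler_sum => l ls.
  rewrite normcM.
  apply: (@le_trans _ _ (delta * (normc (W l) * expR (alpha * ln (normc l) ^+ 2) * D))).
    have := ler_wpM2l (normc_ge0 (W l)) (Pd l ls) => h.
    by have := ler_wpM2r D0 h; rewrite [in X in _ <= X -> _]mulrCA -!mulrA.
  by rewrite ler_wpM2l//; exact: (node_term c0 c1 s0 ssep z0t al0 ls hX hT).
apply: le_trans (ler_wpM2r D0 (normc_sum _ _ _)) _.
pose w := (4 * alpha)^-1.
have w0 : 0 < w by rewrite invr_gt0 mulr_gt0.
have aw : alpha * w = 4^-1 by rewrite /w; field; rewrite gt_eqF.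
have key k : normc (a k * err k) * D <= B * C * expR E *
   (expR (- (k%:R - (m1 + n)%:R - 0) ^+ 2 / (4 * alpha) + 0 * `|k%:R - (m1 + n)%:R|) +
    expR (- (k%:R - m1%:R - 0) ^+ 2 / (4 * alpha) + 0 * `|k%:R - m1%:R|)).
  rewrite !mul0r !addr0 !subr0 normcM.
  have BCE : 0 <= B * C * expR E by rewrite !mulr_ge0// expR_ge0.
  rewrite mulrDr.
  have p1 := mulr_ge0 BCE (expR_ge0 (- (k%:R - (m1 + n)%:R) ^+ 2 / (4 * alpha))).
  have p2 := mulr_ge0 BCE (expR_ge0 (- (k%:R - m1%:R) ^+ 2 / (4 * alpha))).
  have fin e x : normc (err k) <= C * expR e ->
      - k%:R ^+ 2 / (4 * alpha) + e - alpha * t0 ^+ 2 <= E + x ->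
      normc (a k) * normc (err k) * D <= B * C * expR E * expR x.
    move=> he hx.
    apply: (@le_trans _ _ (B * expR (- k%:R ^+ 2 / (4 * alpha)) * (C * expR e) * D)).
      by rewrite ler_wpM2r// ler_pM ?normc_ge0.
    have -> : B * expR (- k%:R ^+ 2 / (4 * alpha)) * (C * expR e) * D =
        B * C * (expR (- k%:R ^+ 2 / (4 * alpha)) * expR e * D) by ring.
    by rewrite -[leRHS]mulrA -!expRD ler_wpM2l ?mulr_ge0// ler_expR.
  have [kbig|ksmall] := leqP (m1 + n) k.
    rewrite (le_trans _ (_ : B * C * expR E * expR (- (k%:R - (m1 + n)%:R) ^+ 2 / (4 * alpha)) <= _))//; last by rewrite lerDl.
    have := @top_error _ _ _ _ _ m1 c0 c1 s0 ssep z0t (k - (m1 + n)) _ t0m sm.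
    rewrite subnKC// => /fin; apply.
    rewrite natrB//; set k0 := (m1 + n)%:R in hE mT *; set kk := k%:R.
    have ik : 0 <= kk - k0 by rewrite subr_ge0 ler_nat.
    (* With [i = kk - k0], this absorbs the growth [i Tm] into the cross term of [(k0 + i)^2 w] and
       leaves the decay [- i^2 w]. *)
    have hT2 : Tm <= 2 * k0 * w by
      have := ler_wpM2r (ltW w0) mT; rewrite (_ : 2 * alpha * Tm * w = 2 * (alpha * w) * Tm);
      [rewrite aw; lra|ring].
    have := ler_wpM2l ik hT2.
    by move: hE; rewrite -/n -/w; lra.
  have [kin|kout] := leqP m1 k.
    have -> : err k = 0.
      by apply: (@monomial_exact _ _ z0 m1 us s0 k); rewrite kin ksmall.
    by rewrite normc0 mulr0 mul0r addr_ge0.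
  rewrite (le_trans _ (_ : B * C * expR E * expR (- (k%:R - m1%:R) ^+ 2 / (4 * alpha)) <= _))//; last by rewrite lerDr.
  have [Tn0 sn mTn hE2] := hb (leq_ltn_trans (leq0n k) kout).
  have := @bottom_error _ _ _ _ _ m1 c0 c1 s0 ssep z0t _ _ _ (subnKC (ltnW kout)) Tn0 sn.
  move=> /fin; apply.
  rewrite natrB 1?ltnW//; set k0 := m1%:R in hE2 mTn *; set kk := k%:R.
  have ik : 0 <= k0 - kk by rewrite subr_ge0 ler_nat ltnW.
  have hT2 : 2 * k0 * w <= Tn by
    have := ler_wpM2r (ltW w0) mTn; rewrite (_ : 2 * alpha * Tn * w = 2 * (alpha * w) * Tn);
    [rewrite aw; lra|ring].
  have := ler_wpM2l ik hT2.
  by move: hE2; rewrite -/w; lra.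
rewrite mulr_suml; apply: le_trans (ler_sum _ (fun (k : 'I_K) _ => key k)) _.
rewrite -mulr_sumr big_split/=.
have -> : B * (2 * G * ((1 + n%:R) * (2 / c) ^+ n * expR E)) = B * C * expR E * (G + G).
  by rewrite /C; ring.
apply: ler_wpM2l; first by rewrite !mulr_ge0// expR_ge0.
by apply: lerD; apply: HG; rewrite lexx ler01.
Qed.

End interpolation_estimate.

(** * Separation and density *)

Section fock_facts.
Variable R : realType.
Implicit Types (alpha B x t e : R) (z l m : R[i]) (f : R[i] -> R[i]) (Lambda : set R[i]).

Lemma weighted_le_phi alpha f z B :
  normc (f z) * expR (- phi alpha z) <= B <-> normc (f z) <= B * expR (phi alpha z).
Proof. by rewrite expRN ler_pdivrMr ?expR_gt0. Qed.

Lemma fock_norm_bound alpha f : fock alpha f -> exists B : R,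
  [/\ 0 <= B, fock_norm alpha f = B%:E & forall z, normc (f z) <= B * expR (phi alpha z)].
Proof.
move=> [_]; set N := fock_norm alpha f => Noo.
have le z : ((normc (f z) * expR (- phi alpha z))%:E <= N)%E.
  by apply: ereal_sup_ubound; exists z.
have N0 : (0 <= N)%E.
  by apply: le_trans (le 0); rewrite lee_fin mulr_ge0 ?normc_ge0 ?expR_ge0.
have NE : N = (fine N)%:E by rewrite fineK// ge0_fin_numE.
exists (fine N); split => //; first exact: fine_ge0.
by move=> z; apply/weighted_le_phi; rewrite -lee_fin -NE.
Qed.

Lemma phi_le alpha z x : 0 <= alpha -> 0 <= x -> normc z <= expR x -> phi alpha z <= alpha * x ^+ 2.
Proof.
move=> al0 x0 zx; rewrite /phi ler_wpM2l// lerXn2r ?nnegrE ?logp_ge0//.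
by have := logp_le zx; rewrite max_l.
Qed.

Lemma phi_polar alpha z x : 0 <= x -> normc z = expR x -> phi alpha z = alpha * x ^+ 2.
Proof. by move=> x0 zx; rewrite /phi zx logp_expR. Qed.

(** Cauchy's estimate on the circle of logarithmic radius [k / (2 alpha)], the minimiser of
    [alpha x^2 - k x]. *)
Lemma taylor_coef_gauss alpha f B k : 0 < alpha -> entire f ->
  (forall z, normc (f z) <= B * expR (phi alpha z)) ->
  normc (taylor_coef f k) <= 2 * B * expR (- k%:R ^+ 2 / (4 * alpha)).
Proof.
move=> al0 ef fB; pose x := k%:R / (2 * alpha).
have x0 : 0 <= x by rewrite divr_ge0// mulr_ge0// ltW.
have := @taylor_coef_le _ f k x (B * expR (alpha * x ^+ 2)) ef.
move=> /(_ _)/wrap[|].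
  by move=> z zx; apply: le_trans (fB z) _; rewrite (phi_polar _ x0 zx).
have -> : 2 * (B * expR (alpha * x ^+ 2)) * expR (- (x *+ k)) =
   2 * B * (expR (alpha * x ^+ 2) * expR (- (x *+ k))) by ring.
rewrite -expRD -mulr_natr; congr (_ <= _ * expR _); rewrite /x; field.
by rewrite gt_eqF.
Qed.

Lemma taylor_cvg_fock alpha f B z e : 0 < alpha -> entire f ->
  (forall z, normc (f z) <= B * expR (phi alpha z)) -> 0 < e ->
  exists K0, forall K, (K0 <= K)%N ->
  normc (f z - \sum_(k < K) taylor_coef f k * z ^+ k) <= e.
Proof.
move=> al0 ef fB e0; apply: taylor_cvg => // x.
have B0 : 0 <= B.
  by have := le_trans (normc_ge0 _) (fB 0); rewrite pmulr_lge0// expR_gt0.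
exists (B * expR (alpha * (Num.max x 0) ^+ 2)) => w wx.
apply: le_trans (fB w) _; rewrite ler_wpM2l// ler_expR; apply: phi_le; first exact: ltW.
  by rewrite le_max lexx orbT.
by rewrite (le_trans wx)// ler_expR le_max lexx.
Qed.

Lemma taylor_cvg_seq alpha f B (s : seq R[i]) e : 0 < alpha -> entire f ->
  (forall z, normc (f z) <= B * expR (phi alpha z)) -> 0 < e ->
  exists K, forall z, z \in s ->
  normc (f z - \sum_(k < K) taylor_coef f k * z ^+ k) <= e.
Proof.
move=> al0 ef fB e0.
suff [K0 H] : exists K0, forall K, (K0 <= K)%N -> forall z, z \in s ->
    normc (f z - \sum_(k < K) taylor_coef f k * z ^+ k) <= e.
  by exists K0 => z; exact: H.
elim: s => [|z s [K1 H1]]; first by exists 0.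
have [K2 H2] := taylor_cvg_fock z al0 ef fB e0.
exists (maxn K1 K2) => K; rewrite geq_max => /andP[k1 k2] w.
by rewrite inE => /orP[/eqP ->|ws]; [exact: H2|exact: H1].
Qed.

(** If the smaller modulus is at least half of the larger, [d_rho] gives the bound; otherwise the
    reverse triangle inequality does. In this form separation is invariant under scaling, hence
    uniform over all annuli. *)
Lemma separation_constant alpha Lambda : 0 < alpha -> d_rho_separated alpha Lambda ->
  exists c : R, [/\ 0 < c, c <= 1 & forall l m, Lambda l -> Lambda m -> l != m ->
    c * Num.max (normc l) (normc m) <= normc (l - m)].
Proof.
move=> al0; rewrite /d_rho_separated; set I := ereal_inf _ => I0.
have [d d0 dI] : exists2 d : R, 0 < d & (d%:E <= I)%E.
  move: I0; case: I => [r r0|_|//]; first by exists r.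
  by exists 1; rewrite ?ltr01 ?leey.
have dle l m : Lambda l -> Lambda m -> l != m -> d <= d_rho alpha l m.
  move=> Ll Lm lm; rewrite -lee_fin (le_trans dI)//.
  by apply: ereal_inf_lbound; exists l, m; split => //; apply/eqP.
pose k := Num.sqrt (2 * alpha); have k0 : 0 < k by rewrite sqrtr_gt0 mulr_gt0.
have dk0 : 0 < d / k by rewrite divr_gt0.
exists (Num.min 2^-1 (d / k / 2)); split.
- by rewrite lt_min invr_gt0 ltr0n divr_gt0.
- by rewrite ge_min; apply/orP; left; lra.
move=> l m Ll Lm lm; have := dle l m Ll Lm lm; rewrite /d_rho -/k.
set M := Num.max _ _; set mi := Num.min _ _ => h.
have mi0 : 0 <= mi by rewrite le_min !normc_ge0.
have M0 : 0 <= M by rewrite le_max normc_ge0.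
have h1 : d / k * mi <= normc (l - m).
  rewrite ler_pdivlMr in h; last by lra.
  rewrite mulrAC ler_pdivrMr// [leRHS]mulrC (le_trans _ h)//.
  by apply: (ler_wpM2l (ltW d0)); rewrite lerDr ltW.
have h2 : M - mi <= normc (l - m).
  by rewrite /M /mi; case: (leP (normc l) (normc m)) => _;
    [rewrite normcB|]; exact: normc_lerB.
have [mm|mm] := leP (M / 2) mi.
  apply: (@le_trans _ _ (d / k / 2 * M)).
    by rewrite ler_wpM2r// ge_min lexx orbT.
  by rewrite (le_trans _ h1)// -mulrA; apply: (ler_wpM2l (ltW dk0)); rewrite mulrC.
apply: (@le_trans _ _ (2^-1 * M)); last by lra.
by rewrite ler_wpM2r// ge_min lexx.
Qed.

Lemma counting_ge (A : set R[i]) (N : nat) : ((N%:R : R)%:E <= counting A)%E ->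
  exists s : seq R[i], [/\ uniq s, size s = N & forall l, l \in s -> A l].
Proof.
move=> NA; have [s [us Ns sA]] : exists s : seq R[i],
    [/\ uniq s, (N <= size s)%N & forall l, l \in s -> A l].
  move: NA; rewrite /counting; case: asboolP => [finA|infA _].
    rewrite lee_fin ler_nat => NA.
    exists (enum_fset (fset_set A)); split => //; first exact: fset_uniq.
    by move=> l lA; apply: set_mem; rewrite -in_fset_set.
  have [D DA DN] := infinite_set_fset N infA.
  by exists (enum_fset D); split => //; exact: fset_uniq.
exists (take N s); split; first exact: take_uniq.
  by rewrite size_take; case: ltngtP Ns.
by move=> l /mem_take; exact: sA.
Qed.

(** The outer lower limit is used for a single ratio [sg], with [S = ln sg], the inner one for all
    large radii. The count, an integer above [2 alpha S], reaches the next integer [N]; the gap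
    [N - 2 alpha S] pays for all later errors. *)
Lemma density_blocks alpha Lambda : 0 < alpha ->
  ((2 * alpha)%:E < lower_density Lambda)%E ->
  exists (S ts : R) (N : nat), [/\ 0 < S, 0 <= ts, 2 * alpha * S < N%:R &
    forall t, ts < t -> exists s : seq R[i], [/\ uniq s, size s = N &
      forall l, l \in s -> [/\ Lambda l, 0 < normc l & t <= ln (normc l) < t + S]]].
Proof.
move=> al0; rewrite /lower_density limf_einfE => /ereal_sup_gt[_ [V [V0 [_ VV]] <-]] hV.
pose sg := Num.max V0 1 + 1.
have sV : V sg by apply: VV; rewrite /sg ltr_pwDr// le_max lexx.
have s1 : 1 < sg by rewrite /sg ltr_pwDr// le_max lexx orbT.
have {hV} := lt_le_trans hV (ereal_inf_lbound _); move=> /(_ _ (ex_intro2 _ _ sg sV erefl)).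
rewrite limf_einfE => /ereal_sup_gt[_ [U [U0 [_ UU]] <-]] hU.
pose S := ln sg; have S0 : 0 < S by rewrite ln_gt0.
pose N := (Num.truncn (2 * alpha * S)).+1.
pose ts := Num.max (ln (Num.max U0 1)) 0.
exists S, ts, N; split => //.
- by rewrite le_max lexx orbT.
- by rewrite /N; exact: truncnS_gt.
move=> t tst; have tU : U (expR t).
  apply: UU; apply: (@le_lt_trans _ _ (Num.max U0 1)); first by rewrite le_max lexx.
  rewrite -ltr_ln ?posrE ?expR_gt0//; last by rewrite lt_max ltr01 orbT.
  by rewrite expRK; apply: le_lt_trans tst; rewrite le_max lexx.
have {hU} := lt_le_trans hU (ereal_inf_lbound _); move=> /(_ _ (ex_intro2 _ _ (expR t) tU erefl)).
set A := Lambda `&` _ => hA.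
have NA : ((N%:R : R)%:E <= counting A)%E.
  rewrite /N; move: hA; rewrite /counting -/S; case: asboolP => [finA|_ _]; last by rewrite leey.
  rewrite -EFinM lte_fin ltr_pdivlMr// lee_fin ler_nat => h.
  by rewrite -(ltr_nat R); apply: le_lt_trans h; rewrite truncn_le !mulr_ge0// ltW.
have [s [us sN sA]] := counting_ge NA.
exists s; split => // l /sA[Ll]; rewrite /annulus/= => /andP[l1 l2].
have l0 : 0 < normc l by apply: lt_le_trans l1; exact: expR_gt0.
split => //; rewrite -[t in t <= _]expRK ler_ln ?posrE ?expR_gt0// l1/=.
rewrite -[t in _ < t + _]expRK addrC -lnM ?posrE ?expR_gt0//; last by apply: lt_trans s1.
by rewrite ltr_ln// posrE mulr_gt0 ?expR_gt0// (lt_trans ltr01).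
Qed.

Section nodes.
Variables (Lambda : set R[i]) (S ts : R) (N : nat).
Hypothesis S0 : 0 < S.
Hypothesis blocks : forall t, ts < t -> exists s : seq R[i], [/\ uniq s, size s = N &
  forall l, l \in s -> [/\ Lambda l, 0 < normc l & t <= ln (normc l) < t + S]].

Lemma nodes_exist J t : ts < t -> exists s : seq R[i], [/\ uniq s, size s = (J * N)%N,
  forall l, l \in s -> [/\ Lambda l, 0 < normc l & t <= ln (normc l) < t + J%:R * S],
  \sum_(l <- s) (ln (normc l) - t) <= N%:R * S * (J%:R * (J%:R + 1) / 2) &
  \sum_(l <- s) (t + J%:R * S - ln (normc l)) <= N%:R * S * (J%:R * (J%:R + 1) / 2)].
Proof.
elim: J t => [|J IH] t tst.
  by exists [::]; split => //; rewrite big_nil !mul0r mulr0.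
have tst' : ts < t + S by rewrite (lt_trans tst)// ltrDl.
have [s1 [u1 n1 h1]] := blocks tst.
have [s2 [u2 n2 h2 su sl]] := IH _ tst'.
have S_gt0 := S0; have JS : 0 <= J%:R * S by rewrite mulr_ge0// ltW.
have cst (s : seq R[i]) (x : R) : \sum_(l <- s) x = (size s)%:R * x.
  by rewrite big_const_seq count_predT iter_addr_0 mulr_natl.
exists (s1 ++ s2); split.
- rewrite cat_uniq u1 u2 andbT/=; apply/hasPn => l /h2[_ _ /andP[l2 _]].
  by apply/negP => /h1[_ _ /andP[_ l1]]; lra.
- by rewrite size_cat n1 n2 mulSn.
- move=> l; rewrite mem_cat -natr1 mulrDl mul1r => /orP[/h1|/h2] [Ll l0 /andP[l1 l2]];
  by split => //; lra.
- rewrite big_cat/= -natr1.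
  have k1 : \sum_(l <- s1) (ln (normc l) - t) <= N%:R * S.
    by rewrite -n1 -cst !big_seq; apply: ler_sum => l /h1[_ _ /andP[? ?]]; lra.
  have k2 : \sum_(l <- s2) (ln (normc l) - t) =
      \sum_(l <- s2) (ln (normc l) - (t + S)) + J%:R * N%:R * S.
    rewrite -natrM -n2 -cst -big_split/=; apply: eq_bigr => l _; ring.
  rewrite k2; lra.
- rewrite big_cat/= -natr1.
  have k1 : \sum_(l <- s1) (t + (J%:R + 1) * S - ln (normc l)) <= N%:R * ((J%:R + 1) * S).
    by rewrite -n1 -cst !big_seq; apply: ler_sum => l /h1[_ _ /andP[? ?]]; lra.
  have k2 : \sum_(l <- s2) (t + (J%:R + 1) * S - ln (normc l)) =
      \sum_(l <- s2) (t + S + J%:R * S - ln (normc l)).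
    by apply: eq_bigr => l _; ring.
  rewrite k2; lra.
Qed.

End nodes.
End fock_facts.

(** * Dense separated sets are sampling *)

Section sufficiency.
Variable R : realType.
Implicit Types (alpha : R) (Lambda : set R[i]).

Lemma expR_quadratic_small (g b e : R) : 0 < g -> 0 < e -> exists J0 : nat,
  forall J : nat, (J0 <= J)%N -> expR (- (g * J%:R ^+ 2) + b * J%:R) <= e.
Proof.
move=> g0 e0; pose M := (`|b| + 1) / g + e^-1.
have e1 : 0 < e^-1 by rewrite invr_gt0.
have M1 : 0 <= (`|b| + 1) / g by rewrite divr_ge0 ?ltW// ltr_pwDr.
exists (Num.bound M) => J JM.
have {JM} : M <= J%:R.
  apply: ltW; apply: lt_le_trans (archi_boundP _) _; last by rewrite ler_nat.
  by rewrite addr_ge0// ltW.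
rewrite /M => MJ.
have h1 : `|b| + 1 <= g * J%:R by rewrite mulrC -ler_pdivrMr//; lra.
have h2 : b * J%:R <= `|b| * J%:R by rewrite ler_wpM2r// ler_norm.
have h3 : (`|b| + 1) * J%:R <= g * J%:R * J%:R by rewrite ler_wpM2r.
apply: (@le_trans _ _ (expR (- J%:R))).
  by rewrite ler_expR expr2; lra.
rewrite expRN -[leRHS]invrK lef_pV2 ?posrE ?expR_gt0//.
have := expR_ge1Dx (J%:R : R); lra.
Qed.

Lemma prefactor_le (c E : R) n : 0 < c -> c <= 1 ->
  (1 + n%:R) * (2 / c) ^+ n * expR E <= expR (n%:R * (1 + ln (2 / c)) + E).
Proof.
move=> c0 c1; rewrite expRD ler_wpM2r ?expR_ge0// mulrDr mulr1 expRD.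
apply: ler_pM; rewrite ?expR_ge1Dx//.
- by rewrite exprn_ge0// divr_ge0// ltW.
- by rewrite expRM_natl lnK// posrE divr_gt0.
Qed.

Lemma sumr_cst (s : seq R[i]) (x : R) : \sum_(l <- s) x = (size s)%:R * x.
Proof. by rewrite big_const_seq count_predT iter_addr_0 mulr_natl. Qed.

(* Far from the origin the nodes are [J] blocks on each side of [z0]; otherwise
   they are [J'] blocks beyond a fixed radius, and no monomial below them is
   left over ([m1 = 0]). *)
Lemma local_estimate alpha Lambda : 0 < alpha -> d_rho_separated alpha Lambda ->
  ((2 * alpha)%:E < lower_density Lambda)%E ->
  exists2 C : R, 0 <= C & forall z0, exists2 s : seq R[i], (forall l, l \in s -> Lambda l) &
  forall (a : nat -> R[i]) K (B delta : R),
  (forall k, normc (a k) <= B * expR (- k%:R ^+ 2 / (4 * alpha))) -> 0 <= delta ->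
  (forall l, l \in s -> normc (\sum_(k < K) a k * l ^+ k) <= delta * expR (phi alpha l)) ->
  normc (\sum_(k < K) a k * z0 ^+ k) * expR (- phi alpha z0) <= C * delta + B / 8.
Proof.
move=> al0 sep dens.
have [c [c0 c1 csep]] := separation_constant al0 sep.
have [S [ts [N [S0 ts0 NS blocks]]]] := density_blocks al0 dens.
have [G G0 HG] := interpolation_estimate al0.
pose w := (4 * alpha)^-1.
have w0 : 0 < w by rewrite invr_gt0 mulr_gt0.
have aw : alpha * w = 4^-1 by rewrite /w; field; rewrite gt_eqF.
have aS0 : 0 < 2 * alpha * S by rewrite !mulr_gt0.
have N0 : 0 < N%:R :> R by rewrite (lt_trans aS0).
(* The coefficient of [J^2] in the net gain, positive by the density hypothesis; everything else in
   the exponents is linear in [J]. *)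
pose g := w * N%:R * (N%:R - 2 * alpha * S).
have g0 : 0 < g by rewrite !mulr_gt0// subr_gt0.
have gE : g = N%:R ^+ 2 * w - N%:R * S / 2.
  rewrite /g (_ : w * N%:R * (N%:R - 2 * alpha * S) = N%:R ^+ 2 * w - 2 * (alpha * w) * N%:R * S); last by ring.
  by rewrite aw; field.
have e0 : 0 < (16 * G)^-1 by rewrite invr_gt0 mulr_gt0.
have big (x y : R) : 0 < y -> exists J0 : nat, forall J : nat, (J0 <= J)%N -> x <= J%:R * y.
  move=> y0; exists (Num.bound `|x / y|) => J J0; rewrite -ler_pdivrMr//.
  apply: le_trans (ler_norm _) (ltW _); apply: lt_le_trans (archi_boundP _) _ => //.
  by rewrite ler_nat.
have NS0 : 0 < N%:R - 2 * alpha * S by rewrite subr_gt0.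
have [J1 HJ1] := @expR_quadratic_small g (2 * N%:R * (1 + ln (2 / c)) + 2 * N%:R * w + N%:R * S / 2) _ g0 e0.
have [J2 HJ2] := big 1 _ NS0.
have [J3 HJ3] := big 1 _ N0.
pose J := maxn J1 (maxn J2 J3).
have {}HJ1 := HJ1 J (leq_maxl _ _).
have {}HJ2 : 1 <= J%:R * (N%:R - 2 * alpha * S) by apply: HJ2; rewrite /J leq_max leq_maxl orbT.
have {}HJ3 : 1 <= J%:R * N%:R :> R by apply: HJ3; rewrite /J leq_max leq_maxr orbT.
have JS0 : 0 <= J%:R * S by rewrite mulr_ge0// ltW.
(* For [t0 >= T1] the left blocks stay beyond [ts], and [2 alpha t0 - J N], the intended lowest
   exact degree, is nonnegative. *)
pose T1 := ts + J%:R * N%:R / (2 * alpha) + 1.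
have T1E : 2 * alpha * T1 = 2 * alpha * (ts + 1) + J%:R * N%:R.
  by rewrite /T1; field; rewrite gt_eqF.
have T1S : ts + 1 + J%:R * S <= T1.
  suff : J%:R * S <= J%:R * N%:R / (2 * alpha) by rewrite /T1; lra.
  by rewrite ler_pdivlMr ?mulr_gt0// -mulrA ler_wpM2l// mulrC ltW.
have [J4 HJ4] := @expR_quadratic_small g (N%:R * (1 + ln (2 / c)) + N%:R * T1 + N%:R * S / 2) _ g0 e0.
have [J5 HJ5] := big (2 * alpha * T1) _ NS0.
pose J' := maxn J4 J5.
have {}HJ4 := HJ4 J' (leq_maxl _ _).
have {}HJ5 := HJ5 J' (leq_maxr _ _).
have JS0' : 0 <= J'%:R * S by rewrite mulr_ge0// ltW.
pose CC n X T := n%:R * ((2 / c) ^+ n * expR (X * T + n%:R * T + alpha * T ^+ 2)).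
have CC0 n X T : 0 <= CC n X T.
  by rewrite !mulr_ge0 ?expR_ge0// exprn_ge0// divr_ge0// ltW.
pose CA := CC (J * N + J * N)%N (J%:R * N%:R + 1) (J%:R * S).
pose CB := CC (J' * N)%N (2 * alpha * T1) (T1 + J'%:R * S).
exists (CA + CB); first by apply: addr_ge0; exact: CC0.
have finish n E B : 0 <= B -> expR (n%:R * (1 + ln (2 / c)) + E) <= (16 * G)^-1 ->
    B * (2 * G * ((1 + n%:R) * (2 / c) ^+ n * expR E)) <= B / 8.
  move=> B0 h; apply: ler_wpM2l => //.
  have -> : 8^-1 = 2 * G * (16 * G)^-1 by field; rewrite gt_eqF.
  apply: ler_wpM2l; first by rewrite mulr_ge0// ltW.
  by apply: le_trans h; exact: prefactor_le.
have phiE l : 0 <= ln (normc l) -> phi alpha l = alpha * ln (normc l) ^+ 2.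
  by move=> l0; rewrite /phi /logp max_l.
move=> z0; pose t0 := logp (normc z0).
have t00 : 0 <= t0 by exact: logp_ge0.
have z0t : normc z0 <= expR t0 by exact: le_expR_logp.
rewrite -[phi alpha z0]/(alpha * t0 ^+ 2).
have [big0|small0] := leP T1 t0.
- clear HJ4 HJ5 JS0' e0.
  have tsL : ts < t0 - J%:R * S by lra.
  have tsR : ts < t0 by lra.
  have [sL [uL nL hL _ slL]] := nodes_exist S0 blocks J tsL.
  have [sR [uR nR hR suR _]] := nodes_exist S0 blocks J tsR.
  rewrite subrK in hL slL.
  have inLR l : l \in sL ++ sR ->
     [/\ Lambda l, 0 < normc l & t0 - J%:R * S <= ln (normc l) <= t0 + J%:R * S].
    rewrite mem_cat => /orP[/hL|/hR] [Ll l0 /andP[l1 l2]];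
      split => //; clear -l1 l2 JS0; lra.
  have sz : size (sL ++ sR) = (J * N + J * N)%N by rewrite size_cat nL nR.
  exists (sL ++ sR); first by move=> l /inLR[].
  move=> a K B delta aB d0 Pd.
  have B0 : 0 <= B.
    by have := le_trans (normc_ge0 _) (aB 0); rewrite pmulr_lge0// expR_gt0.
  have m0 : 0 <= 2 * alpha * t0 - J%:R * N%:R.
    move: al0 (ler_wpM2l (ltW al0) big0) (mulr_ge0 (ltW al0) ts0) T1E; clear; lra.
  (* The [2 J N] exact degrees are centred at [2 alpha t0], where the weighted monomials peak at
     [z0]. Rounding down is the reason for the [- 1] in [E]; the other term of [E] is the sum of
     logarithmic distances on one side. *)
  pose m1 := Num.truncn (2 * alpha * t0 - J%:R * N%:R).
  have /andP[m1l m1u] := Num.Theory.truncn_itv m0; rewrite -/m1 -natr1 in m1l m1u.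
  pose E := - (J%:R * N%:R - 1) ^+ 2 * w + N%:R * S * (J%:R * (J%:R + 1) / 2).
  have JNE : (J * N + J * N)%:R = J%:R * N%:R + J%:R * N%:R :> R by rewrite natrD natrM.
  have tt : alpha * t0 ^+ 2 = (2 * alpha * t0) ^+ 2 * w.
    rewrite (_ : (2 * alpha * t0) ^+ 2 * w = 4 * (alpha * w) * alpha * t0 ^+ 2); last by ring.
    by rewrite aw; field.
  have JN1 : 0 <= J%:R * N%:R - 1 :> R by rewrite subr_ge0.
  apply: le_trans (HG c t0 (sL ++ sR) z0 m1 K a B delta (t0 - J%:R * S) (t0 + J%:R * S)
    (J%:R * N%:R + 1) (J%:R * S) E c0 c1 _ _ _ z0t aB d0 _ _ _ _ _ _ _ _) _.
  + rewrite cat_uniq uL uR andbT/=; apply/hasPn => l /hR[_ _ /andP[l2 _]].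
    by apply/negP => /hL[_ _ /andP[_ l1]]; rewrite ltNge l2 in l1.
  + by move=> l /inLR[].
  + by move=> l m /inLR[? _ _] /inLR[? _ _]; exact: csep.
  + move=> l ls; have [_ _ /andP[l1 _]] := inLR l ls.
    by rewrite -phiE; [exact: Pd|exact: le_trans ts0 (le_trans (ltW tsL) l1)].
  + by rewrite lerDl.
  + by move=> l /inLR[_ _ /andP[]].
  + by rewrite sz natrD JNE; move: m1u HJ2; clear; lra.
  + rewrite sz big_cat/= (eq_big_seq (fun=> t0)); last first.
      by move=> l /hL[_ _ /andP[_ l1]]; rewrite max_l// ltW.
    rewrite sumr_cst nL (eq_big_seq (fun l => ln (normc l) - t0 + t0) (r := sR)); last first.
      by move=> l /hR[_ _ /andP[l1 _]]; rewrite max_r// subrK.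
    rewrite big_split/= sumr_cst nR.
    have : (J%:R * N%:R - 1) ^+ 2 * w <= ((m1 + (J * N + J * N))%:R - 2 * alpha * t0) ^+ 2 * w.
      have k : J%:R * N%:R - 1 <= (m1 + (J * N + J * N))%:R - 2 * alpha * t0.
        by rewrite natrD JNE; move: m1u; clear; lra.
      by rewrite ler_pM2r// lerXn2r ?nnegrE// (le_trans JN1).
    rewrite tt /E -/w; move: (m1 + _)%:R (natrD R m1 (J * N + J * N)) => K0 K0E.
    have cr : alpha * w * (K0 * t0) = 4^-1 * (K0 * t0) by rewrite aw.
    rewrite natrM; rewrite JNE in K0E; rewrite K0E in cr *.
    move: suR cr; clear; lra.
  + move=> _; split.
    * by rewrite gerBl.
    * by move=> l /inLR[_ _ /andP[]].
    * by move: m1l HJ2; clear; lra.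
    * rewrite big_cat/= (eq_big_seq (fun l => t0 - ln (normc l))); last first.
        by move=> l /hL[_ _ /andP[_ l1]]; rewrite max_l// ltW.
      rewrite [X in _ + (_ + X) - _ <= _]big1_seq ?addr0; last first.
        by move=> l /andP[_ /hR[_ _ /andP[l1 _]]]; rewrite max_r// subrr.
      have : (J%:R * N%:R - 1) ^+ 2 * w <= (2 * alpha * t0 - m1%:R) ^+ 2 * w.
        have k : J%:R * N%:R - 1 <= 2 * alpha * t0 - m1%:R.
          by move: m1l; clear; lra.
        by rewrite ler_pM2r// lerXn2r ?nnegrE// (le_trans JN1).
      have cr : alpha * w * (m1%:R * t0) = 4^-1 * (m1%:R * t0) by rewrite aw.
      rewrite tt /E -/w; move: slL cr; clear; lra.
  + by rewrite ler_norml; move: m1l m1u HJ3; clear; lra.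
  + by move=> m /inLR[_ _ /andP[l1 l2]]; rewrite ler_norml; move: l1 l2; clear; lra.
  rewrite sz -/(CC _ _ _) -/CA; apply: lerD.
    by rewrite mulrC ler_wpM2r// lerDl CC0.
  apply: finish => //; apply: le_trans HJ1; rewrite ler_expR gE JNE /E.
  move: w0; clear; nra.
- clear HJ1 HJ2 HJ3 e0.
  have tsB : ts < ts + 1 by rewrite ltrDl.
  have [s [us sn hs su _]] := nodes_exist S0 blocks J' tsB.
  exists s; first by move=> l /hs[].
  move=> a K B delta aB d0 Pd.
  have B0 : 0 <= B.
    by have := le_trans (normc_ge0 _) (aB 0); rewrite pmulr_lge0// expR_gt0.
  (* As [t0] stays below the fixed [T1], replacing the maxima by [T1] plus the distances to [ts + 1]
     costs [J' N T1], which is linear in [J']. *)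
  pose E := - (J'%:R * N%:R) ^+ 2 * w + J'%:R * N%:R * T1 + N%:R * S * (J'%:R * (J'%:R + 1) / 2).
  apply: le_trans (HG c t0 s z0 0%N K a B delta 0 (T1 + J'%:R * S)
    (2 * alpha * T1) (T1 + J'%:R * S) E c0 c1 us _ _ z0t aB d0 _ _ _ _ _ _ _ _) _.
  + by move=> l /hs[].
  + by move=> l m /hs[? _ _] /hs[? _ _]; exact: csep.
  + move=> l ls; have [_ _ /andP[l1 _]] := hs l ls.
    by rewrite -phiE; [exact: Pd|apply: le_trans l1; rewrite addr_ge0].
  + by rewrite ler_wpDr// ltW.
  + by move=> l /hs[_ _ /andP[_ l2]]; move: l2 T1S JS0; clear; lra.
  + by rewrite sn add0n natrM; move: HJ5; clear; lra.
  + rewrite sn add0n natrM mul0r addr0 -/w.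
    have : \sum_(m <- s) Num.max t0 (ln (normc m)) <=
        \sum_(m <- s) (ln (normc m) - (ts + 1)) + \sum_(m <- s) T1.
      rewrite -big_split/= !big_seq; apply: ler_sum => l /hs[_ _ /andP[l1 _]].
      by rewrite ge_max; move: small0 l1 T1S JS0; clear; lra.
    rewrite sumr_cst sn natrM /E.
    move: (mulr_ge0 (ltW al0) (sqr_ge0 t0)) su; clear; lra.
  + by [].
  + rewrite subr0 ger0_norm; last by rewrite !mulr_ge0// ltW.
    by apply: ler_wpM2l; [rewrite mulr_ge0// ltW|exact: ltW].
  + move=> m /hs[_ _ /andP[l1 l2]]; rewrite ler_norml.
    move: l1 l2 T1S JS0 JS0' ts0 t00 small0; clear; lra.
  rewrite sn -/(CC _ _ _) -/CB; apply: lerD.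
    by rewrite mulrC ler_wpM2r// lerDr CC0.
  apply: finish => //; apply: le_trans HJ4; rewrite ler_expR gE natrM /E.
  by clear; lra.
Qed.

End sufficiency.

Section sampling.
Variable R : realType.

Lemma le_limit_eps (x y C : R) : (forall e, 0 < e -> x <= y + C * e) -> x <= y.
Proof.
move=> H; apply/ler_addgt0Pr => e e0.
have C0 : 0 < `|C| + 1 by rewrite ltr_wpDl.
apply: (le_trans (H (e / (`|C| + 1)) (divr_gt0 e0 C0))).
rewrite lerD2l mulrA ler_pdivrMr// mulrC ler_pM2l//.
by rewrite (le_trans (ler_norm _))// lerDl.
Qed.

(** The supremum over [z] of the local estimate gives [B <= C d + B / 4] for the finite norm [B],
    and the last term is absorbed. *)
Lemma sampling_of_density (alpha : R) (Lambda : set R[i]) : 0 < alpha ->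
  d_rho_separated alpha Lambda -> ((2 * alpha)%:E < lower_density Lambda)%E ->
  sampling alpha Lambda.
Proof.
move=> al0 sep dens.
have [C C0 HC] := local_estimate al0 sep dens.
(* A point of [Lambda] makes the supremum over [Lambda] nonnegative instead of [-oo]. *)
have [l0 L0] : exists l, Lambda l.
  have [S [ts [N [S0 _ NS blocks]]]] := density_blocks al0 dens.
  have [|s [_ sN sL]] := blocks (ts + 1); first by rewrite ltrDl.
  case: s sN sL => [N0|l s _ /(_ l (mem_head _ _))[? _ _]]; last by exists l.
  by move: NS; rewrite -N0 ltNge !mulr_ge0// ltW.
exists (2 * C + 1); first by rewrite ltr_wpDl// mulr_ge0.
move=> f Ff; have [B [B0 NB fB]] := fock_norm_bound Ff.
have ef : entire f by case: Ff.
set W := weighted_sup alpha Lambda f.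
have Wge l : Lambda l -> ((normc (f l) * expR (- phi alpha l))%:E <= W)%E.
  by move=> Ll; apply: ereal_sup_ubound; exists l.
have WB : (W <= B%:E)%E.
  apply: ge_ereal_sup => _ [l _ <-]; rewrite lee_fin; exact/weighted_le_phi.
have W0 : (0 <= W)%E.
  by apply: le_trans (Wge _ L0); rewrite lee_fin mulr_ge0 ?normc_ge0 ?expR_ge0.
have WE : W = (fine W)%:E by rewrite fineK// ge0_fin_numE// (le_lt_trans WB)// ltry.
pose d := fine W; have d0 : 0 <= d by exact: fine_ge0.
have phi0 z : 0 <= phi alpha z by rewrite mulr_ge0 ?sqr_ge0// ltW.
have fd l : Lambda l -> normc (f l) <= d * expR (phi alpha l).
  by move=> Ll; apply/weighted_le_phi; rewrite -lee_fin -WE Wge.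
rewrite NB WE -EFinM lee_fin -/d.
suff H z : normc (f z) * expR (- phi alpha z) <= C * d + B / 4.
  suff : B <= C * d + B / 4 by nra.
  rewrite -lee_fin -NB; apply: ge_ereal_sup => _ [z _ <-]; rewrite lee_fin; exact: H.
have [s sL Hs] := HC z.
apply: (@le_limit_eps _ _ (C + 1)) => e e0.
(* The nodes depend on [z] alone, so one truncation order serves [z] and all of them. The
   coefficient bound is [2 * B], whence [2 * B / 8 = B / 4]. *)
have [K HK] := taylor_cvg_seq (z :: s) al0 ef fB e0.
have e1 l : e <= e * expR (phi alpha l).
  by rewrite ler_pMr// -expR0 ler_expR.
have : normc (\sum_(k < K) taylor_coef f k * z ^+ k) * expR (- phi alpha z) <=
    C * (d + e) + 2 * B / 8.
  apply: Hs => [k||l ls]; [exact: taylor_coef_gauss|by rewrite addr_ge0// ltW|].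
  have := HK l; rewrite inE ls orbT => /(_ isT) h.
  have h2 := fd l (sL l ls); have h3 := e1 l.
  rewrite -[X in normc X](subrK (f l)) (le_trans (normcD_le _ _))// normcB mulrDl; lra.
have hz := HK z (mem_head _ _).
have : normc (f z) * expR (- phi alpha z) <=
   normc (\sum_(k < K) taylor_coef f k * z ^+ k) * expR (- phi alpha z) + e.
  have h1 : normc (f z) <= normc (\sum_(k < K) taylor_coef f k * z ^+ k) + e.
    have := normc_lerB (f z) (\sum_(k < K) taylor_coef f k * z ^+ k); lra.
  apply: le_trans (ler_wpM2r (expR_ge0 _) h1) _.
  rewrite mulrDl lerD2l; apply: ler_piMr; first exact: ltW.
  by rewrite -expR0 ler_expR oppr_le0.
lra.
Qed.

End sampling.

(** * Polynomials in the Fock space *)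

Section polynomials.
Variable R : realType.
Variable alpha : R.
Hypothesis al0 : 0 < alpha.
Implicit Types (p : {poly R[i]}) (z w : R[i]).

Lemma entire_sum (K : nat) (a : nat -> R[i]) : entire (fun z => \sum_(k < K) a k * z ^+ k).
Proof.
elim: K => [|K IH] z.
  rewrite (_ : (fun z : R[i] => _) = fun=> 0); first exact: derivable_cst.
  by apply/funext => w; rewrite big_ord0.
rewrite (_ : (fun z : R[i] => _) =
    (fun z : R[i] => \sum_(k < K) a k * z ^+ k + a K * z ^+ K)); last first.
  by apply/funext => w; rewrite big_ord_recr.
apply: (@derivableD _ R[i]^o R[i]^o (fun z => \sum_(k < K) a k * z ^+ k)).
  exact: IH.
apply: (@derivableM _ _ (fun _ : R[i]^o => a K) (fun z : R[i]^o => z ^+ K)).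
  exact: derivable_cst.
exact: entire_expn.
Qed.

Lemma taylor_coef_sum (K : nat) (a : nat -> R[i]) k :
  taylor_coef (fun z => \sum_(j < K) a j * z ^+ j) k = if (k < K)%N then a k else 0.
Proof.
rewrite /taylor_coef.
under eq_fun do rewrite mulr_suml.
under eq_fun do under eq_bigr do rewrite -mulrA.
rewrite (@cmean_sum _ K a (fun j y => polar 0 y ^+ j / polar 0 y ^+ k)); last first.
  by move=> j; apply: (@ccontR_div_exp _ (fun z => z ^+ j)); exact: entire_expn.
have E j : cmean (fun y => polar 0 y ^+ j / polar 0 y ^+ k) = (j == k)%:R :> R[i].
  exact: (@taylor_coef_expn R j k).
under eq_bigr do rewrite E mulr_natr mulrb.
rewrite -big_mkcond/=; case: ifPn => kK.
  by rewrite (big_pred1 (Ordinal kK)).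
by rewrite big1// => i /eqP ik; move: kK; rewrite -ik ltn_ord.
Qed.

Lemma coef_le p (B : R) k : (forall z, normc p.[z] <= B * expR (phi alpha z)) ->
  normc p`_k <= 2 * B * expR (- k%:R ^+ 2 / (4 * alpha)).
Proof.
move=> pB.
have -> : p`_k = taylor_coef (fun z => \sum_(j < size p) p`_j * z ^+ j) k.
  by rewrite taylor_coef_sum; case: ltnP => // ?; rewrite nth_default.
apply: taylor_coef_gauss => //; first exact: entire_sum.
by move=> z; rewrite -horner_coef.
Qed.

(** The completed square behind all estimates: at logarithmic modulus [x] the degrees that matter
    are those near [2 alpha x]. *)
Lemma gauss_shift (k x : R) :
  - k ^+ 2 / (4 * alpha) + k * x - alpha * x ^+ 2 = - (k - 2 * alpha * x) ^+ 2 / (4 * alpha).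
Proof. by field; rewrite gt_eqF. Qed.

Lemma monomial_le z k :
  normc z ^+ k <= expR (k%:R ^+ 2 / (4 * alpha)) * expR (phi alpha z).
Proof.
pose x := logp (normc z).
apply: (@le_trans _ _ (expR x ^+ k)).
  by rewrite lerXn2r ?nnegrE ?normc_ge0 ?expR_ge0// le_expR_logp.
rewrite -expRM_natl -expRD ler_expR /phi -/x.
have := gauss_shift k%:R x.
have : 0 <= (k%:R - 2 * alpha * x) ^+ 2 / (4 * alpha).
  by rewrite divr_ge0 ?sqr_ge0// mulr_ge0// ltW.
rewrite !mulNr; lra.
Qed.

Lemma poly_fock p : fock alpha (horner p).
Proof.
have -> : horner p = fun z => \sum_(k < size p) p`_k * z ^+ k.
  by apply/funext => z; rewrite horner_coef.
split; first exact: entire_sum.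
pose M := \sum_(k < size p) normc p`_k * expR (k%:R ^+ 2 / (4 * alpha)).
apply: (@le_lt_trans _ _ M%:E); last by rewrite ltry.
apply: ge_ereal_sup => _ [z _ <-]; rewrite lee_fin expRN ler_pdivrMr ?expR_gt0//.
rewrite (le_trans (normc_sum _ _ _))// mulr_suml; apply: ler_sum => k _.
by rewrite normcM normcX -mulrA ler_wpM2l ?normc_ge0// monomial_le.
Qed.

Lemma subXX_le z w (r : R) j : normc z <= r -> normc w <= r ->
  normc (z ^+ j - w ^+ j) * r <= j%:R * r ^+ j * normc (z - w).
Proof.
move=> zr wr; have r0 : 0 <= r by apply: le_trans zr; exact: normc_ge0.
elim: j => [|j IH]; first by rewrite !expr0 subrr normc0 !mul0r.
have -> : z ^+ j.+1 - w ^+ j.+1 = z * (z ^+ j - w ^+ j) + (z - w) * w ^+ j.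
  by rewrite !exprS; ring.
apply: le_trans (ler_wpM2r r0 (normcD_le _ _)) _.
rewrite !normcM normcX mulrDl.
have h1 : normc z * normc (z ^+ j - w ^+ j) * r <= r * (j%:R * r ^+ j * normc (z - w)).
  by rewrite -mulrA ler_pM ?normc_ge0// mulr_ge0// normc_ge0.
have h2 : normc (z - w) * normc w ^+ j * r <= normc (z - w) * r ^+ j * r.
  by rewrite ler_wpM2r// ler_wpM2l ?normc_ge0// lerXn2r ?nnegrE ?normc_ge0.
rewrite -natr1 exprS; lra.
Qed.

Lemma natr_le_exp2 j : j%:R <= 2 ^+ j :> R.
Proof. by rewrite -natrX ler_nat ltnW// ltn_expl. Qed.

(** The factor [(z / w)^m] makes the difference vanish at [k = m]; away from it the loss depends on
    [|k - m|] and not on [k], which a Gaussian sum tolerates. In [8 = 4 * 2], the [4] covers [j 2^j]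
    and the [2] the division by powers of [w]. *)
Lemma monomial_diff (t : R) z w m k : normc z <= expR t -> normc w <= 2 * expR t ->
  ((0 < m)%N -> z != 0 /\ expR t <= 2 * normc w) ->
  normc (z ^+ k - (z / w) ^+ m * w ^+ k) <=
  expR (k%:R * t) * expR (ln 8 * `|k%:R - m%:R|) * (normc (z - w) / expR t).
Proof.
set r := expR t => zr wr hm.
have r0 : 0 < r by exact: expR_gt0.
have pow8 j : expR (ln 8 * j%:R) = 8 ^+ j :> R by rewrite mulrC expRM_natl lnK// posrE.
have rk j : expR (j%:R * t) = r ^+ j by rewrite expRM_natl.
have zr2 : normc z <= 2 * r by lra.
have sub j : normc (z ^+ j - w ^+ j) <= 4 ^+ j * r ^+ j * (normc (z - w) / r).
  have := subXX_le j zr2 wr; rewrite -ler_pdivlMr ?mulr_gt0// => /le_trans; apply.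
  rewrite exprMn (_ : 4 = 2 * 2) ?exprMn; last by ring.
  have := natr_le_exp2 j.
  rewrite invfM !mulrA ler_pM2r ?invr_gt0// => h.
  have : j%:R * (2 ^+ j * r ^+ j * normc (z - w)) <= 2 ^+ j * (2 ^+ j * r ^+ j * normc (z - w)).
    by rewrite ler_wpM2r// !mulr_ge0 ?normc_ge0 ?exprn_ge0// ltW.
  have : 0 <= 2 ^+ j * (2 ^+ j * r ^+ j * normc (z - w)).
    by rewrite !mulr_ge0 ?normc_ge0 ?exprn_ge0// ltW.
  lra.
have zw0 : 0 <= normc (z - w) / r by rewrite divr_ge0 ?normc_ge0// ltW.
rewrite rk; have [mk|km] := leqP m k.
  rewrite -natrB// ger0_norm// pow8 -(subnKC mk) addKn; move: (k - m)%N => j.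
  have -> : z ^+ (m + j) - (z / w) ^+ m * w ^+ (m + j) = z ^+ m * (z ^+ j - w ^+ j).
    have [m0|m0] := posnP m; first by rewrite m0 !expr0 add0n !mul1r.
    have [z0 rw] := hm m0.
    have w0 : w != 0 by rewrite -normc_gt0; lra.
    by rewrite !exprD expr_div_n; field; rewrite expf_neq0.
  rewrite normcM normcX exprD.
  have -> : r ^+ m * r ^+ j * 8 ^+ j * (normc (z - w) / r) =
     r ^+ m * (8 ^+ j * r ^+ j * (normc (z - w) / r)) by ring.
  apply: ler_pM; rewrite ?exprn_ge0 ?normc_ge0//.
    by rewrite lerXn2r ?nnegrE ?normc_ge0// ltW.
  apply: le_trans (sub j) _; rewrite -!mulrA ler_wpM2r//.
    by rewrite mulr_ge0// exprn_ge0// ltW.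
  by rewrite lerXn2r ?nnegrE// ler_nat.
rewrite distrC -natrB 1?ltnW// ger0_norm// pow8.
have [z0 rw] := hm (leq_ltn_trans (leq0n k) km).
have w0 : w != 0 by rewrite -normc_gt0; lra.
have nw0 : 0 < normc w by rewrite normc_gt0.
rewrite -{1}(subnKC (ltnW km)); move: (m - k)%N => i.
have -> : z ^+ k - (z / w) ^+ (k + i) * w ^+ k = - (z ^+ k * ((z ^+ i - w ^+ i) / w ^+ i)).
  by rewrite !exprD !expr_div_n; field; rewrite !expf_neq0.
rewrite normcN normcM normcX normcM normcV normcX -mulrA.
apply: ler_pM; rewrite ?exprn_ge0 ?normc_ge0//.
- by rewrite divr_ge0 ?exprn_ge0 ?normc_ge0.
- by rewrite lerXn2r ?nnegrE ?normc_ge0// ltW.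
rewrite ler_pdivrMr ?exprn_gt0// (le_trans (sub i))//.
have : r ^+ i <= 2 ^+ i * normc w ^+ i.
  by rewrite -exprMn lerXn2r ?nnegrE ?mulr_ge0 ?normc_ge0// ltW.
move=> h; have -> : 8 ^+ i * (normc (z - w) / r) * normc w ^+ i =
   4 ^+ i * (2 ^+ i * normc w ^+ i) * (normc (z - w) / r).
  by rewrite (_ : 8 = 4 * 2) ?exprMn; ring.
by rewrite ler_wpM2r// ler_wpM2l// exprn_ge0.
Qed.

End polynomials.

Section bernstein.
Variable R : realType.
Variable alpha : R.
Hypothesis al0 : 0 < alpha.
Implicit Types (z w : R[i]).

(** The power [m], close to [2 alpha t], cancels the linear part of [alpha t'^2 - alpha t^2]; as
    [2 <= e], the numbers [t] and [t'] differ by at most [1]. *)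
Lemma weight_ratio z w (t := logp (normc z)) (t' := logp (normc w))
    (m := Num.truncn (2 * alpha * t)) :
  expR t <= 2 * expR t' -> expR t' <= 2 * expR t ->
  ((0 < m)%N -> expR t <= 2 * normc w) ->
  normc ((z / w) ^+ m) * expR (- (alpha * t ^+ 2)) <=
  expR (2 * alpha + 1) * expR (- (alpha * t' ^+ 2)).
Proof.
move=> h1 h2 hm; have al := al0.
have t0 : 0 <= t by exact: logp_ge0.
have t'0 : 0 <= t' by exact: logp_ge0.
have e2 : 2 <= expR 1 :> R by have := expR_ge1Dx (1 : R); lra.
have tt' : t <= t' + 1.
  rewrite -ler_expR expRD mulrC; apply: le_trans h1 _.
  by rewrite ler_wpM2r ?expR_ge0.
have t't : t' <= t + 1.
  rewrite -ler_expR expRD mulrC; apply: le_trans h2 _.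
  by rewrite ler_wpM2r ?expR_ge0.
have at0 : 0 <= 2 * alpha * t by rewrite !mulr_ge0// ltW.
have /andP[ml mu] := Num.Theory.truncn_itv at0; rewrite -/m -natr1 in ml mu.
have zt : normc z <= expR t by exact: le_expR_logp.
rewrite -expRD.
suff : exists2 e, normc ((z / w) ^+ m) <= expR e & e - alpha * t ^+ 2 <= 2 * alpha + 1 - alpha * t' ^+ 2.
  move=> [e he1 he2]; apply: le_trans (ler_wpM2r (expR_ge0 _) he1) _.
  by rewrite -expRD ler_expR.
have sq : alpha * (t' - t) ^+ 2 <= alpha.
  rewrite -[leRHS]mulr1 ler_pM2l// -real_normK ?num_real// expr_le1// ler_norml; lra.
have lin x : 0 <= x -> x <= 1 -> x * (t' - t) <= 1.
  move=> x0 x1; apply: (@le_trans _ _ (x * 1)); last by rewrite mulr1.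
  by rewrite ler_wpM2l//; lra.
have sqE : alpha * t' ^+ 2 = alpha * t ^+ 2 + alpha * (t' - t) ^+ 2 + 2 * alpha * t * (t' - t) by ring.
have [m0|m0] := posnP m.
  exists 0; first by rewrite m0 expr0 normc1 expR0.
  rewrite m0 in mu; have := lin (2 * alpha * t) at0; lra.
have wt := hm m0; have et := expR_gt0 t.
have nw : 0 < normc w by lra.
have [w1|w1] := leP 1 (normc w).
  exists (m%:R * (t - t')).
    rewrite normcX normcM normcV expRM_natl lerXn2r ?nnegrE ?expR_ge0 ?divr_ge0 ?normc_ge0//.
    rewrite expRB /t' logp_ln// lnK ?posrE//.
    by rewrite ler_wpM2r// invr_ge0 ltW.
  have := lin (2 * alpha * t - m%:R); rewrite subr_ge0 => /(_ ml); lra.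
(* With [w] in the unit disc, [t] is at most [1], so [m <= 2 alpha] and [|z / w| <= 2] suffice. *)
have t'E : t' = 0.
  apply/eqP; rewrite eq_le t'0 andbT /t'.
  by apply: le_trans (logp_le (x := 0) _) _; rewrite ?expR0 ?maxxx// ltW.
exists (2 * alpha); last first.
  by rewrite t'E expr0n/= mulr0; have := mulr_ge0 (ltW al0) (sqr_ge0 t); lra.
apply: (@le_trans _ _ (expR 1 ^+ m)).
  rewrite normcX lerXn2r ?nnegrE ?expR_ge0 ?normc_ge0//.
  by rewrite normcM normcV ler_pdivrMr//; nra.
rewrite -expRM_natl mulr1 ler_expR (le_trans ml)//.
rewrite t'E add0r in tt'.
by rewrite -[leRHS]mulr1; apply: ler_wpM2l => //; rewrite mulr_ge0// ltW.
Qed.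

(** The value at [z] is compared with [(z / w)^m] times the value at [w], [m] being the integer part
    of [2 alpha t]. Comparing the values directly would bring a factor [k] into the monomial
    differences, unbounded as [z] goes to infinity. *)
Lemma bernstein : exists C e0 : R, [/\ 1 <= C, 0 < e0 &
  forall (a : nat -> R[i]) K (B : R) z w, 0 <= B ->
  (forall k, normc (a k) <= B * expR (- k%:R ^+ 2 / (4 * alpha))) ->
  d_rho alpha z w <= e0 ->
  normc (\sum_(k < K) a k * z ^+ k) * expR (- phi alpha z) <=
  C * (normc (\sum_(k < K) a k * w ^+ k) * expR (- phi alpha w)) + C * d_rho alpha z w * B].
Proof.
have al := al0.
have ln8 : 0 <= ln 8 :> R by rewrite ln_ge0//; lra.
have [G G0 HG] := gauss_sum al0 ln8.
pose kap := Num.sqrt (2 * alpha); have k0 : 0 < kap by rewrite sqrtr_gt0 mulr_gt0.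
pose C1 := expR (2 * alpha + 1); pose C2 := G * (kap + 1) / kap.
have C10 : 0 <= C1 by exact: expR_ge0.
have C20 : 0 <= C2 by rewrite divr_ge0 ?mulr_ge0 ?ltW//; lra.
(* This threshold makes [|z - w|] at most half of [max 1 |z|] and of [max 1 |w|]. [C1] compares the
   weights, [C2] sums the monomial differences. *)
exists (C1 + C2), (kap / (2 * (kap + 1))).
have C11 : 1 <= C1 by rewrite -expR0 ler_expR; lra.
split; [lra|by rewrite divr_gt0//; lra|].
move=> a K B z w B0 aB; rewrite /d_rho -/kap.
set mi := Num.min _ _; set u := normc (z - w); set d := _ / _ => de0.
have mi0 : 0 <= mi by rewrite le_min !normc_ge0.
have u0 : 0 <= u by exact: normc_ge0.
have km : 0 < kap + mi by lra.
have d0 : 0 <= d by rewrite divr_ge0 ?mulr_ge0// ltW.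
have uE : u = d * (kap + mi) / kap by rewrite /d; field; lra.
pose t := logp (normc z); pose t' := logp (normc w).
have zt : normc z <= expR t by exact: le_expR_logp.
have wt : normc w <= expR t' by exact: le_expR_logp.
have ge1 x : 1 <= expR (logp x) :> R by rewrite -expR0 ler_expR logp_ge0.
have upper (r : R) : 1 <= r -> mi <= r -> u <= r / 2 /\ u <= (kap + 1) / kap * d * r.
  move=> r1 mr.
  have kr : kap + mi <= (kap + 1) * r by nra.
  have h : u <= (kap + 1) / kap * d * r.
    rewrite uE (_ : (kap + 1) / kap * d * r = d * ((kap + 1) * r) / kap); last by field; lra.
    by rewrite ler_pM2r ?invr_gt0// ler_wpM2l.
  split=> //; apply: le_trans h _.
  rewrite mulrC -[leRHS]mulrC mulrC [leRHS]mulrC -subr_ge0.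
  have : (kap + 1) / kap * d <= (kap + 1) / kap * (kap / (2 * (kap + 1))).
    by rewrite ler_wpM2l// divr_ge0//; lra.
  rewrite (_ : _ * (kap / _) = 2^-1); last by field; lra.
  by move=> h; have := ler_wpM2r (le_trans ler01 r1) h; lra.
have [ut ut2] : u <= expR t / 2 /\ u <= (kap + 1) / kap * d * expR t.
  by apply: upper; rewrite ?ge1// (le_trans _ zt)// ge_min lexx.
have [ut' _] : u <= expR t' / 2 /\ u <= (kap + 1) / kap * d * expR t'.
  by apply: upper; rewrite ?ge1// (le_trans _ wt)// ge_min lexx orbT.
have logpE x : expR (logp x) <= Num.max 1 x :> R.
  have [x0|x0] := leP x 0; first by rewrite /logp ln0// maxxx expR0 le_max lexx.
  rewrite /logp; case: (leP (ln x) 0) => _; first by rewrite expR0 le_max lexx.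
  by rewrite lnK ?posrE// le_max lexx orbT.
have zu : normc z <= normc w + u.
  by have := normc_lerB z w; rewrite -/u; lra.
have wu : normc w <= normc z + u.
  by have := normc_lerB w z; rewrite normcB -/u; lra.
have tt' : expR t <= 2 * expR t'.
  apply: le_trans (logpE _) _; rewrite ge_max; have := ge1 (normc w); rewrite -/t'; lra.
have t't : expR t' <= 2 * expR t.
  apply: le_trans (logpE _) _; rewrite ge_max; have := ge1 (normc z); rewrite -/t; lra.
pose m := Num.truncn (2 * alpha * t).
have at0 : 0 <= 2 * alpha * t by rewrite !mulr_ge0 ?logp_ge0// ltW.
have hm : (0 < m)%N -> z != 0 /\ expR t <= 2 * normc w.
  move=> m0; have /andP[ml mu] := Num.Theory.truncn_itv at0.
  have t0 : 0 < t.
    have a2 : 0 < 2 * alpha by rewrite mulr_gt0.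
    rewrite -(pmulr_rgt0 t a2).
    by apply: lt_le_trans ml; rewrite ltr0n.
  have zE : normc z = expR t.
    have z1 : 1 < normc z.
      rewrite ltNge; apply/negP => z1; move: t0; rewrite ltNge => /negP; apply.
      by apply: le_trans (logp_le (x := 0) _) _; rewrite ?expR0 ?maxxx.
    by rewrite /t logp_ln 1?ltW// lnK// posrE (lt_trans ltr01).
  split; last by lra.
  by rewrite -normc_gt0 zE expR_gt0.
have hm2 m0 := (hm m0).2.
have W : normc ((z / w) ^+ m) * expR (- (alpha * t ^+ 2)) <=
  C1 * expR (- (alpha * t' ^+ 2)) := weight_ratio tt' t't hm2.
have th : 0 <= 2 * alpha * t - m%:R <= 1.
  have /andP[ml mu] := Num.Theory.truncn_itv at0; rewrite -/m -natr1 in ml mu; lra.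
clearbody m.
rewrite -[phi alpha z]/(alpha * t ^+ 2) -[phi alpha w]/(alpha * t' ^+ 2).
have -> : \sum_(k < K) a k * z ^+ k = (z / w) ^+ m * \sum_(k < K) a k * w ^+ k +
    \sum_(k < K) a k * (z ^+ k - (z / w) ^+ m * w ^+ k).
  by rewrite mulr_sumr -big_split/=; apply: eq_bigr => k _;
    rewrite mulrBr mulrCA addrC subrK.
have E0 := expR_ge0 (- (alpha * t ^+ 2)).
rewrite (le_trans (ler_wpM2r E0 (normcD_le _ _)))// mulrDl.
apply: lerD.
  have q0 := normc_ge0 (\sum_(k < K) a k * w ^+ k).
  have := ler_wpM2r q0 W; rewrite normcM.
  set q := normc _ in q0 *; move=> h.
  rewrite [leLHS]mulrAC; apply: le_trans h _; rewrite -mulrA [expR (- _) * q]mulrC.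
  by rewrite ler_wpM2r ?mulr_ge0 ?expR_ge0// lerDl.
apply: (@le_trans _ _ (C2 * d * B)); last first.
  by rewrite ler_wpM2r// ler_wpM2r// lerDr.
rewrite (le_trans (ler_wpM2r E0 (normc_sum _ _ _)))//.
rewrite mulr_suml.
have ut3 : u / expR t <= (kap + 1) / kap * d by rewrite ler_pdivrMr ?expR_gt0.
apply: (@le_trans _ _ (B * ((kap + 1) / kap * d) * G)); last first.
  by rewrite (_ : _ * G = C2 * d * B)//; rewrite /C2; ring.
apply: le_trans (ler_wpM2l _ (HG K m _ th)); last first.
  by apply: mulr_ge0 => //; apply: mulr_ge0 => //; apply: divr_ge0; lra.
rewrite mulr_sumr; apply: ler_sum => k _.
rewrite normcM.
have := @monomial_diff R t z w m k zt (le_trans wt t't) hm; rewrite -/u => hk.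
apply: (@le_trans _ _ (B * expR (- k%:R ^+ 2 / (4 * alpha)) *
   (expR (k%:R * t) * expR (ln 8 * `|k%:R - m%:R|) * ((kap + 1) / kap * d)) * expR (- (alpha * t ^+ 2)))).
  rewrite ler_wpM2r ?expR_ge0// ler_pM ?normc_ge0//.
  by rewrite (le_trans hk)// ler_wpM2l// mulr_ge0 ?expR_ge0.
rewrite [leLHS](_ : _ = B * ((kap + 1) / kap * d) * (expR (- k%:R ^+ 2 / (4 * alpha)) *
   expR (k%:R * t) * expR (- (alpha * t ^+ 2)) * expR (ln 8 * `|k%:R - m%:R|))); last by ring.
rewrite -!expRD gauss_shift// (_ : k%:R - m%:R - (2 * alpha * t - m%:R) = k%:R - 2 * alpha * t)//.
by ring.
Qed.

End bernstein.

(** * Density of sampling sets *)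

Section necessity.
Variable R : realType.
Variable alpha : R.
Hypothesis al0 : 0 < alpha.
Implicit Types (p : {poly R[i]}) (z w l : R[i]) (Lambda : set R[i]).

Lemma d_rho_sym z w : d_rho alpha z w = d_rho alpha w z.
Proof. by rewrite /d_rho normcB minC. Qed.

Lemma maximal_separated Lambda (e : R) : exists M : set R[i], [/\ M `<=` Lambda,
  (forall z w, M z -> M w -> z <> w -> e <= d_rho alpha z w) &
  forall l, Lambda l -> M l \/ exists2 m, M m & d_rho alpha l m < e].
Proof.
pose P (A : set R[i]) := A `<=` Lambda /\
  forall z w, A z -> A w -> z <> w -> e <= d_rho alpha z w.
have [F FP Ftot|M [[ML Msep] Mmax]] := @Zorn_bigcup _ P.
  split; first by move=> z [A FA Az]; have [+ _] := FP A FA; exact.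
  move=> z w [A FA Az] [A' FA' Aw].
  have [AA|AA] := Ftot _ _ FA FA'.
    by have [_] := FP _ FA'; apply; [exact: AA|].
  by have [_] := FP _ FA; apply; [|exact: AA].
exists M; split => // l Ll; apply: contrapT => /not_orP[nMl near].
have far m : M m -> e <= d_rho alpha l m.
  by move=> Mm; rewrite leNgt; apply/negP => lm; apply: near; exists m.
apply: (Mmax (M `|` [set l])).
  split; first by move=> z; left.
  by move=> /(_ l (or_intror erefl)).
split; first by move=> z [/ML//|->].
move=> z w [Mz|->] [Mw|->] zw //; [exact: Msep| |exact: far].
by rewrite d_rho_sym; exact: far.
Qed.

(** By maximality each point of [Lambda] is [e]-close to [M], so [bernstein] transfers bounds from
    [M] to [Lambda] up to a small multiple of the norm of [p]. *)
Lemma sampling_poly Lambda : sampling alpha Lambda -> exists2 M : set R[i],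
  M `<=` Lambda /\ d_rho_separated alpha M &
  exists2 L : R, 0 < L & forall p (D : R), 0 <= D ->
    (forall l, M l -> normc p.[l] <= D * expR (phi alpha l)) ->
    forall z, normc p.[z] <= L * D * expR (phi alpha z).
Proof.
move=> [L L0 HL]; have [C [e0 [C1 e00 HC]]] := bernstein al0.
have C0 : 0 < C by lra.
(* The second entry gives [2 L C e <= 1 / 4], so that the norm [B] can be absorbed. *)
pose e := Num.min e0 (8 * L * C)^-1.
have e_gt0 : 0 < e by rewrite lt_min e00 invr_gt0 !mulr_gt0.
have [M [ML Msep Mnear]] := maximal_separated Lambda e.
exists M.
  split=> //; apply: (@lt_le_trans _ _ e%:E); first by rewrite lte_fin.
  apply: le_ereal_inf_tmp => _ [z [w [Mz Mw zw ->]]]; rewrite lee_fin; exact: Msep.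
exists (2 * L * C); first by rewrite !mulr_gt0.
move=> p D D0 pD z.
have Fp := poly_fock al0 p.
have [B [B0 NB pB]] := fock_norm_bound Fp.
suff BD : B <= 2 * L * C * D.
  by apply: le_trans (pB z) _; rewrite ler_wpM2r ?expR_ge0.
have coefB k := coef_le al0 k pB.
have : (weighted_sup alpha Lambda (horner p) <= (C * D + C * e * (2 * B))%:E)%E.
  apply: ge_ereal_sup => _ [l Ll <-]; rewrite lee_fin.
  have CB0 : 0 <= C * e * (2 * B) by rewrite !mulr_ge0// ltW.
  have pD' m : M m -> normc p.[m] * expR (- phi alpha m) <= D.
    by move=> Mm; rewrite expRN ler_pdivrMr ?expR_gt0// pD.
  have CD : D <= C * D by rewrite ler_peMl.
  have [Ml|[m Mm lm]] := Mnear l Ll; first by have := pD' l Ml; lra.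
  have B20 : 0 <= 2 * B by rewrite mulr_ge0.
  have := HC (fun k => p`_k) (size p) (2 * B) l m B20 coefB.
  rewrite -!horner_coef => /(_ _)/wrap[|h].
    by apply: le_trans (ltW lm) _; rewrite ge_min lexx.
  apply: le_trans h _; apply: lerD.
    by apply: ler_wpM2l; [exact: ltW|exact: pD'].
  by rewrite ler_wpM2r// ler_wpM2l ?ltW.
move=> WC; have := HL _ Fp; rewrite NB.
move=> /le_trans -/(_ _ (lee_wpmul2l _ WC)); rewrite lee_fin ltW// => /(_ isT).
rewrite -EFinM lee_fin => h.
have : L * (C * e * (2 * B)) <= B / 4.
  have -> : L * (C * e * (2 * B)) = 2 * L * C * B * e by ring.
  apply: (@le_trans _ _ (2 * L * C * B * (8 * L * C)^-1)).
    by rewrite ler_wpM2l ?ge_min ?lexx ?orbT// !mulr_ge0// ltW.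
  by rewrite le_eqVlt; apply/orP; left; apply/eqP; field; rewrite !gt_eqF.
have : 0 <= L * C * D by rewrite !mulr_ge0// ltW.
lra.
Qed.

Lemma limf_einf_lt (f : R -> \bar R) (c : R) : (limf_einf f (pinfty_nbhs R) < c%:E)%E ->
  forall M : R, exists2 x, M < x & (f x < c%:E)%E.
Proof.
rewrite limf_einfE => fc M; apply: contrapT => H.
move: fc; rewrite ltNge => /negP; apply.
apply: le_trans (ereal_sup_ubound _); last first.
  exists [set x | M < x] => //; exists M; split; first exact: num_real.
  by move=> x.
apply: le_ereal_inf_tmp => _ [x /= Mx <-].
by rewrite leNgt; apply/negP => fx; apply: H; exists x.
Qed.

Lemma normc_prod_le (s : seq R[i]) z (F : R[i] -> R) :
  (forall l, l \in s -> normc z + normc l <= F l) ->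
  normc (\prod_(l <- s) ('X - l%:P)).[z] <= \prod_(l <- s) F l.
Proof.
move=> zF; rewrite horner_prod normc_prod !big_seq; apply: ler_prod => l ls.
rewrite normc_ge0/= !hornerE; exact: le_trans (normcB_le _ _) (zF l ls).
Qed.

(** [m x - alpha x^2] increases up to its apex [m / (2 alpha)]; [parabola_right] is the decreasing
    side. *)
Lemma parabola_left (m x y : R) : x <= y -> 2 * alpha * y <= m ->
  m * x <= m * y - alpha * y ^+ 2 + alpha * x ^+ 2.
Proof.
move=> xy ym; have : 0 <= (y - x) * (m - alpha * (x + y)).
  rewrite mulr_ge0 ?subr_ge0//.
  have : alpha * x <= alpha * y by rewrite ler_wpM2l// ltW.
  by lra.
by lra.
Qed.

Lemma parabola_right (m x y : R) : x <= y -> m <= 2 * alpha * x ->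
  m * y <= m * x - alpha * x ^+ 2 + alpha * y ^+ 2.
Proof.
move=> xy mx; have : 0 <= (y - x) * (alpha * (x + y) - m).
  rewrite mulr_ge0 ?subr_ge0//.
  have : alpha * x <= alpha * y by rewrite ler_wpM2l// ltW.
  by lra.
by lra.
Qed.

(** Here [2 alpha S] will bound the logarithm of [2^n], and the square is the Gaussian gain, which
    wins for large [S]. *)
Lemma final_exponent (ep w S : R) : 0 < w -> 0 <= S ->
  2 * alpha + 2 * ep * w + 1 <= ep ^+ 2 * w * S ->
  2 * alpha * S - (ep * S - 1) ^+ 2 * w <= - S.
Proof.
move=> w0 S0 h; have := ler_wpM2r S0 h.
have -> : (ep * S - 1) ^+ 2 * w = ep ^+ 2 * w * S * S - 2 * ep * w * S + w by ring.
by lra.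
Qed.

Lemma density_of_sampling_poly (M : set R[i]) (L : R) : 0 < L ->
  (forall p (D : R), 0 <= D ->
    (forall l, M l -> normc p.[l] <= D * expR (phi alpha l)) ->
    forall z, normc p.[z] <= L * D * expR (phi alpha z)) ->
  ((2 * alpha)%:E <= lower_density M)%E.
Proof.
move=> L0 HL; rewrite leNgt; apply/negP => dens.
have [c [c0 c2 dc]] : exists c : R, [/\ 0 <= c, c < 2 * alpha & (lower_density M < c%:E)%E].
  have a2 : 0 < 2 * alpha by rewrite mulr_gt0.
  move: dens; case: (lower_density M) => [r| |]; last 2 first.
  - by rewrite ltNge leey.
  - by move=> _; exists 0; split => //; exact: ltNyr.
  rewrite lte_fin => r2; exists (Num.max 0 ((r + 2 * alpha) / 2)); split.
  - by rewrite le_max lexx.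
  - by rewrite gt_max a2/=; lra.
  - by rewrite lte_fin lt_max; apply/orP; right; lra.
pose w := (4 * alpha)^-1; have w0 : 0 < w by rewrite invr_gt0 mulr_gt0.
have aw : alpha * w = 4^-1 by rewrite /w; field; rewrite gt_eqF.
(* Half of the density deficit: it is shared equally between the inner and the outer circle. *)
pose ep := (2 * alpha - c) / 2; have ep0 : 0 < ep by rewrite /ep; lra.
have g0 : 0 < ep ^+ 2 * w by rewrite mulr_gt0// exprn_gt0.
pose b := 2 * alpha + 2 * ep * w.
have b0 : 0 < b by rewrite /b; have := mulr_gt0 ep0 w0; have := al0; lra.
(* The first term serves [final_exponent], [4 * L] lets [expR S] exceed the constant, and [ep^-1]
   makes [a] positive. *)
pose S1 := (b + 1) / (ep ^+ 2 * w) + 4 * L + ep^-1.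
have bg : 0 < (b + 1) / (ep ^+ 2 * w) by apply: divr_gt0 => //; lra.
have e1 : 0 < ep^-1 by rewrite invr_gt0.
have S10 : 0 < S1 by rewrite /S1; lra.
have [s hs] := limf_einf_lt dc (expR S1).
set f := (fun r => _) => hf.
have [r r1 hr] := limf_einf_lt hf 1; rewrite /f in hr; clear hf f.
pose S := ln s.
have s0 : 0 < s by apply: lt_trans hs; exact: expR_gt0.
have SS1 : S1 < S by rewrite -(expRK S1) ltr_ln ?posrE ?expR_gt0.
have S0 : 0 < S by lra.
have r0 : 0 < r by lra.
pose t0 := ln r; have t00 : 0 < t0 by rewrite ln_gt0.
have rE : expR t0 = r by rewrite lnK.
have srE : expR (t0 + S) = s * r by rewrite expRD !lnK// mulrC.
set A := M `&` _ in hr.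
have [finA nS] : finite_set A /\ (#|` fset_set A|)%:R < c * S.
  move: hr; rewrite /counting; case: asboolP => [finA|_].
    by rewrite -EFinM lte_fin ltr_pdivrMr.
  by rewrite gt0_mulye// lte_fin invr_gt0.
pose F := enum_fset (fset_set A).
have [n nE] : exists n, n = size F by exists (size F).
rewrite -[#|` _|]/(size F) -nE in nS.
have uF : uniq F by exact: fset_uniq.
have FA l : (l \in F) <-> (M l /\ r <= normc l < s * r).
  split=> [lF|MA].
    by have : A l by apply: set_mem; rewrite -in_fset_set.
  by have : l \in fset_set A by rewrite in_fset_set//; exact: mem_set.
(* With this [m] the slope of [log |p| - phi], as a function of [log |z|], is at
   least [a] at the inner radius and at most [- a] at the outer one. *)
have em0 : 0 <= 2 * alpha * t0 + ep * S by
  have := mulr_ge0 (ltW al0) (ltW t00); have := mulr_ge0 (ltW ep0) (ltW S0); lra.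
have [m [ml mu]] : exists m : nat, m%:R <= 2 * alpha * t0 + ep * S /\
    2 * alpha * t0 + ep * S < m%:R + 1.
  exists (Num.truncn (2 * alpha * t0 + ep * S)).
  by have /andP[] := Num.Theory.truncn_itv em0; rewrite natr1.
pose a := ep * S - 1.
have a0 : 0 < a.
  have : ep^-1 < S by move: SS1; rewrite /S1; lra.
  by rewrite -(ltr_pM2l ep0) divff ?gt_eqF// /a; lra.
pose t1 := t0 + S.
have am : a <= m%:R - 2 * alpha * t0 by rewrite /a; lra.
have amn : (m + n)%:R - 2 * alpha * t1 <= - a.
  have : n%:R < 2 * alpha * S - 2 * ep * S.
    by apply: lt_le_trans nS _; rewrite /ep; lra.
  by rewrite natrD /a /t1; lra.
pose Pi := \prod_(l <- F) normc l.
have Pi0 : 0 < Pi.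
  rewrite /Pi big_seq; apply: prodr_gt0 => l /FA[_ /andP[rl _]]; lra.
(* [E0] and [E1] are the weighted sizes of the lowest and highest terms of [p] on the two boundary
   circles. Up to [2^n] they bound [p] inside and outside the annulus: each factor is at most twice
   the modulus of the root, respectively of the variable, and the parabolas are monotone there. *)
pose E0 := expR (m%:R * t0 - alpha * t0 ^+ 2) * Pi.
pose E1 := expR ((m + n)%:R * t1 - alpha * t1 ^+ 2).
have E00 : 0 <= E0 by rewrite mulr_ge0 ?expR_ge0// ltW.
have E10 : 0 < E1 by exact: expR_gt0.
pose D := 2 ^+ n * (E0 + E1).
have two0 : 0 < 2 ^+ n :> R by rewrite exprn_gt0.
have D0 : 0 < D by rewrite mulr_gt0// ltr_wpDl.
pose q : {poly R[i]} := \prod_(l <- F) ('X - l%:P).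
pose p : {poly R[i]} := 'X^m * q.
have sq : size q = n.+1 by rewrite /q size_prod_XsubC nE.
have pE z : p.[z] = z ^+ m * q.[z] by rewrite hornerM hornerXn.
have pD l : M l -> normc p.[l] <= D * expR (phi alpha l).
  move=> Ml; have [lF|lF] := boolP (l \in F).
    rewrite pE /q horner_prod (big_rem l)//= hornerXsubC subrr mul0r mulr0 normc0.
    by rewrite mulr_ge0 ?expR_ge0// ltW.
  rewrite pE normcM normcX.
  have al := al0; have DE : D = 2 ^+ n * E0 + 2 ^+ n * E1 by rewrite /D mulrDr.
  pose ta := logp (normc l); have ta0 : 0 <= ta by exact: logp_ge0.
  have lta : normc l <= expR ta by exact: le_expR_logp.
  have lm k : normc l ^+ k <= expR (k%:R * ta).
    by rewrite expRM_natl lerXn2r ?nnegrE ?normc_ge0 ?expR_ge0.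
  rewrite -[phi alpha l]/(alpha * ta ^+ 2).
  have [lr|rl] := ltP (normc l) r.
    apply: (@le_trans _ _ (2 ^+ n * E0 * expR (alpha * ta ^+ 2))); last first.
      by rewrite ler_wpM2r ?expR_ge0// DE lerDl; apply: mulr_ge0; exact: ltW.
    apply: (@le_trans _ _ (expR (m%:R * ta) * (2 ^+ n * Pi))).
      rewrite ler_pM ?normc_ge0 ?exprn_ge0 ?normc_ge0//.
      have -> : 2 ^+ n * Pi = \prod_(k <- F) (2 * normc k).
        by rewrite big_split/= big_const_seq count_predT -Monoid.iteropE nE.
      apply: normc_prod_le => k /FA[_ /andP[rk _]].
      by rewrite mulr2n mulrDl mul1r lerD2r (le_trans (ltW lr)).
    have tat : ta <= t0.
      by have := logp_le (x := t0) (t := normc l); rewrite rE (ltW lr) (max_l (ltW t00)) => /(_ isT).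
    rewrite /E0 [leRHS](_ : _ = expR (m%:R * t0 - alpha * t0 ^+ 2) * expR (alpha * ta ^+ 2) * (2 ^+ n * Pi)); last by ring.
    have P0 : 0 <= 2 ^+ n * Pi by apply: mulr_ge0; exact: ltW.
    rewrite ler_wpM2r// -expRD ler_expR.
    by apply: parabola_left => //; rewrite -subr_ge0 (le_trans (ltW a0)).
  have srl : s * r <= normc l.
    by rewrite leNgt; apply/negP => lsr; move/negP: lF; apply; apply/FA; rewrite rl lsr.
  have tat : t1 <= ta.
    rewrite -ler_expR srE; exact: le_trans srl lta.
  apply: (@le_trans _ _ (2 ^+ n * E1 * expR (alpha * ta ^+ 2))); last first.
    by rewrite ler_wpM2r ?expR_ge0// DE lerDr; apply: mulr_ge0 => //; exact: ltW.
  apply: (@le_trans _ _ (normc l ^+ m * (2 ^+ n * normc l ^+ n))).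
    rewrite ler_wpM2l ?exprn_ge0 ?normc_ge0//.
    have -> : 2 ^+ n * normc l ^+ n = \prod_(k <- F) (2 * normc l).
      by rewrite -exprMn big_const_seq count_predT -Monoid.iteropE nE.
    apply: normc_prod_le => k /FA[_ /andP[_ ksr]].
    by rewrite mulr2n mulrDl mul1r lerD2l (le_trans (ltW ksr)).
  rewrite mulrCA -exprD -mulrA ler_pM2l// (le_trans (lm _))// -expRD ler_expR.
  by apply: parabola_right => //; rewrite -subr_le0 (le_trans amn)// oppr_le0 ltW.
have coefs k := coef_le al0 k (HL p D (ltW D0) pD).
have p_m : normc p`_m = Pi.
  rewrite coefXnM ltnn subnn -horner_coef0 /q horner_prod normc_prod.
  by apply: eq_bigr => l _; rewrite !hornerE normcN.
have p_mn : normc p`_(m + n) = 1.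
  rewrite coefXnM ltnNge leq_addr/= addKn.
  have /monicP : q \is monic by exact: monic_prod_XsubC.
  by rewrite lead_coefE sq/= => ->; rewrite normc1.
have gs (k : nat) t : a <= `|k%:R - 2 * alpha * t| ->
    expR (k%:R * t - alpha * t ^+ 2) * expR (- k%:R ^+ 2 / (4 * alpha)) <= expR (- (a ^+ 2 * w)).
  move=> h; rewrite -expRD ler_expR.
  rewrite (_ : _ + _ = - k%:R ^+ 2 / (4 * alpha) + k%:R * t - alpha * t ^+ 2); last by ring.
  rewrite gauss_shift// mulNr lerN2 ler_pM2r// -[leRHS]real_normK ?num_real//.
  by rewrite lerXn2r// nnegrE// ltW.
have LD0 : 0 <= 2 * (L * D) by apply: mulr_ge0 => //; apply: mulr_ge0; exact: ltW.
have h0 : E0 <= 2 * (L * D) * expR (- (a ^+ 2 * w)).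
  have := coefs m; rewrite p_m => cm.
  apply: le_trans (ler_wpM2l (expR_ge0 _) cm) _.
  rewrite mulrCA ler_wpM2l// gs//.
  by rewrite (le_trans am)// ler_norm.
have h1 : E1 <= 2 * (L * D) * expR (- (a ^+ 2 * w)).
  have := coefs (m + n)%N; rewrite p_mn => cm.
  rewrite -[E1]mulr1; apply: le_trans (ler_wpM2l (expR_ge0 _) cm) _.
  rewrite mulrCA ler_wpM2l// gs//.
  by rewrite -normrN (le_trans _ (ler_norm _))// lerNr.
(* The coefficient bound returns [E0] and [E1] as small multiples of [D], which is [2^n] times their
   sum, so [D] cancels. *)
have hD : D <= 2 ^+ n * (4 * (L * D) * expR (- (a ^+ 2 * w))).
  apply: (@le_trans _ _ (2 ^+ n * (E0 + E1))) => //.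
  by rewrite (ler_pM2l two0) (le_trans (lerD h0 h1))// -mulrDl -mulrDl -natrD.
have {hD} : 1 <= 4 * L * (2 ^+ n * expR (- (a ^+ 2 * w))).
  rewrite -(ler_pM2l D0) mulr1 (le_trans hD)// le_eqVlt; apply/orP; left; apply/eqP; ring.
apply/negP; rewrite -ltNge.
have n2 : 2 ^+ n <= expR (2 * alpha * S).
  apply: (@le_trans _ _ (expR 1 ^+ n)).
    by rewrite lerXn2r ?nnegrE ?expR_ge0//; have := expR_ge1Dx (1 : R); lra.
  rewrite -expRM_natl mulr1 ler_expR (le_trans (ltW nS))// ler_wpM2r// ltW//.
apply: (@le_lt_trans _ _ (4 * L * expR (- S))).
  rewrite ler_wpM2l//; first by rewrite mulr_ge0// ltW.
  apply: le_trans (ler_wpM2r (expR_ge0 _) n2) _.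
  rewrite -expRD ler_expR.
  apply: final_exponent => //; first exact: ltW.
  rewrite [leRHS]mulrC -ler_pdivrMr//; apply: ltW; apply: le_lt_trans SS1.
  by rewrite /S1 -[leRHS]addrA lerDl; apply: addr_ge0; rewrite ?mulr_ge0// ltW.
rewrite expRN ltr_pdivrMr ?expR_gt0// mul1r.
by apply: lt_le_trans (expR_ge1Dx S); move: SS1; rewrite /S1; lra.
Qed.

End necessity.

Theorem theorem1p4 (R : realType) (alpha : R) (alpha_gt0 : 0 < alpha) :
  (forall Lambda : set R[i], countable Lambda ->
     d_rho_separated alpha Lambda ->
     ((2 * alpha)%:E < lower_density Lambda)%E ->
     sampling alpha Lambda) /\
  (forall Lambda : set R[i], countable Lambda ->
     sampling alpha Lambda ->
     exists Lambda' : set R[i],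
       [/\ Lambda' `<=` Lambda,
           d_rho_separated alpha Lambda' &
           ((2 * alpha)%:E <= lower_density Lambda')%E]).
Proof.
split=> Lambda _; first exact: sampling_of_density.
move=> /(sampling_poly alpha_gt0)[M [ML Msep] [L L0 HL]].
by exists M; split => //; exact: density_of_sampling_poly HL.
Qed.
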